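(* Let $d,n\geq 1$ and let $C\in\mathbb{R}^{dn\times dn}$ be a real symmetric positive semidefinite matrix with $d\times d$ blocks $C_{ij}$. Let $X_1,\dots,X_n\in\mathbb{R}^{d\times nd}$ be an optimal solution of \[ \max_{\substack{X_iX_i^T=I_{d\times d},\ X_i\in\mathbb{R}^{d\times nd}}}\ \sum_{i=1}^n\sum_{j=1}^n\operatorname{tr}\left(C_{ij}^TX_iX_j^T\right), \] let $R\in\mathbb{R}^{nd\times d}$ have i.i.d. real $\mathcal{N}(0,\frac1d)$ entries, and set $V_i=\mathcal{P}(X_iR)$ for $i=1,\dots,n$. Then \[ \mathbb{E} \left[ \sum_{i=1}^n\sum_{j=1}^n\operatorname{tr}\left(C_{ij}^TV_iV_j^T\right) \right] \geq \alpha_{\mathbb{R}}(d)^2 \max_{O_1,\dots,O_n \in \mathcal{O}_d} \sum_{i=1}^n\sum_{j=1}^n\operatorname{tr}\left(C_{ij}^TO_iO_j^T\right). \] Analogously, let $C\in\mathbb{C}^{dn\times dn}$ be Hermitian positive semidefinite, let $Y_1,\dots,Y_n\in\mathbb{C}^{d\times nd}$ be an optimal solution of \[ \max_{\substack{Y_iY_i^H=I_{d\times d},\ Y_i\in\mathbb{C}^{d\times nd}}}\ \sum_{i=1}^n\sum_{j=1}^n\operatorname{tr}\left(C_{ij}^HY_iY_j^H\right), \] let $R\in\mathbb{C}^{nd\times d}$ have i.i.d. complex Gaussian $\mathcal{N}(0,\frac1d)$ entries, and set $W_i=\mathcal{P}(Y_iR)$. Then \[ \mathbb{E} \left[ \sum_{i=1}^n\sum_{j=1}^n\operatorname{tr}\left(C_{ij}^HW_iW_j^H\right)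 \right] \geq \alpha_{\mathbb{C}}(d)^2 \max_{U_1,\dots,U_n \in \mathcal{U}_d} \sum_{i=1}^n\sum_{j=1}^n\operatorname{tr}\left(C_{ij}^HU_iU_j^H\right). \]
   Context: $\mathcal{O}_d$ is the group of real $d\times d$ orthogonal matrices and $\mathcal{U}_d$ the group of complex $d\times d$ unitary matrices. $C_{ij}$ denotes the $(i,j)$-th $d\times d$ block of $C$. For a real $d\times d$ matrix $X$, $\mathcal{P}(X)=\operatorname{argmin}_{Z\in\mathcal{O}_d}\|Z-X\|_F$ (the orthogonal polar factor, $UV^T$ if $X=U\Sigma V^T$ is an SVD); for a complex $d\times d$ matrix $Y$, $\mathcal{P}(Y)=\operatorname{argmin}_{Z\in\mathcal{U}_d}\|Z-Y\|_F$. A complex Gaussian $\mathcal{N}(0,\frac1d)$ entry is circularly symmetric with $\mathbb{E}|z|^2=\frac1d$. Let $G_{\mathbb{R}}\in\mathbb{R}^{d\times d}$ have i.i.d. real $\mathcal{N}(0,d^{-1})$ entries and $G_{\mathbb{C}}\in\mathbb{C}^{d\times d}$ i.i.d. complex $\mathcal{N}(0,d^{-1})$ entries; define $\alpha_{\mathbb{R}}(d)=\mathbb{E}\left[\frac1d\sum_{j=1}^d\sigma_j(G_{\mathbb{R}})\right]$ and $\alpha_{\mathbb{C}}(d)=\mathbb{E}\left[\frac1d\sum_{j=1}^d\sigma_j(G_{\mathbb{C}})\right]$, where $\sigma_j$ denotes the $j$-th singular value. *)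

(* Defs.v *)
From HB Require Import structures.
From mathcomp Require Import all_boot all_order all_algebra.
From mathcomp Require Import all_classical all_reals all_analysis.
From mathcomp Require Import complex.
Set Implicit Arguments. Unset Strict Implicit. Unset Printing Implicit Defensive.
Import Order.TTheory GRing.Theory Num.Theory.
Local Open Scope ring_scope.

Lemma bidx_proof (n d : nat) (i : 'I_n) (a : 'I_d) : (i * d + a < n * d)%N.
Proof.
case: i => i hi; case: a => a ha /=.
have : (i.+1 * d <= n * d)%N by rewrite leq_mul2r hi orbT.
by rewrite mulSn; apply: leq_trans; rewrite addnC ltn_add2r.
Qed.
Definition bidx (n d : nat) (i : 'I_n) (a : 'I_d) : 'I_(n * d) :=
  Ordinal (bidx_proof i a).

Section Defs.
Variable R : realType.

(* gexp s k F = E[F(x)] where x : nat -> R has coordinates x_0..x_{k-1} *)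
(* i.i.d. real N(0, s^2) (s = standard deviation) and x_i = 0 for i>=k, *)
(* written as the iterated integral against the product Gaussian law.  *)
Fixpoint gexp (s : R) (k : nat) (F : (nat -> R) -> \bar R) : \bar R :=
  match k with
  | 0 => F (fun _ => 0)
  | k'.+1 => (\int[normal_prob 0 s]_x
               gexp s k' (fun v => F (fun i => if i == k' then x else v i)))%E
  end.

Definition gaussR_E (m k : nat) (s : R) (f : 'M[R]_(m, k) -> R) : \bar R :=
  gexp s (m * k) (fun v => (f (\matrix_(i, j) v (bidx i j)))%:E).

(* E[f(G)] for G an m x k complex matrix with i.i.d. circularly symmetric
   complex Gaussian entries with E|z|^2 = t: real and imaginary parts are
   i.i.d. real N(0, t/2). *)
Definition gaussC_E (m k : nat) (t : R) (f : 'M[R[i]]_(m, k) -> R) : \bar R :=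
  gexp (Num.sqrt (t / 2)) (2 * (m * k))
    (fun v => (f (\matrix_(i, j) Complex (v (bidx i j))
                                          (v ((m * k) + bidx i j)%N)))%:E).

Arguments gaussR_E m k s f : clear implicits.
Arguments gaussC_E m k t f : clear implicits.

Definition orthogonalR (d : nat) (Z : 'M[R]_d) : Prop := Z *m Z^T = 1%:M.

Definition frobR (m k : nat) (A : 'M[R]_(m, k)) : R :=
  Num.sqrt (\sum_i \sum_j A i j ^+ 2).

Definition polarR (d : nat) (X : 'M[R]_d) : 'M[R]_d :=
  xget 0 [set Z | orthogonalR Z /\
                  forall Z', orthogonalR Z' -> frobR (Z - X) <= frobR (Z' - X)].

Definition sv_sumR (d : nat) (G : 'M[R]_d) : R :=
  \sum_j (xget 0 [set s : 'rV[R]_d | (forall j, 0 <= s 0 j) /\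
             exists U V : 'M[R]_d, orthogonalR U /\ orthogonalR V /\
                G = U *m diag_mx s *m V^T]) 0 j.

Definition alphaR (d : nat) : \bar R :=
  gaussR_E d d (Num.sqrt (d%:R^-1))%R (fun G => d%:R^-1 * sv_sumR G)%R.

Definition blkR (n d : nat) (C : 'M[R]_(n * d)) (i j : 'I_n) : 'M[R]_d :=
  \matrix_(a, b) C (bidx i a) (bidx j b).

Definition objR (n d k : nat) (C : 'M[R]_(n * d)) (V : 'I_n -> 'M[R]_(d, k)) : R :=
  \sum_i \sum_j \tr ((blkR C i j)^T *m V i *m (V j)^T).

Definition sym_psd (N : nat) (C : 'M[R]_N) : Prop :=
  C^T = C /\ forall v : 'cV[R]_N, 0 <= (v^T *m C *m v) 0 0.

Definition ctr (m k : nat) (A : 'M[R[i]]_(m, k)) : 'M[R[i]]_(k, m) :=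
  (map_mx (@conjc R) A)^T.

Definition unitaryC (d : nat) (Z : 'M[R[i]]_d) : Prop := Z *m ctr Z = 1%:M.

Definition frobC (m k : nat) (A : 'M[R[i]]_(m, k)) : R :=
  Num.sqrt (\sum_i \sum_j (complex.Re (A i j) ^+ 2 + complex.Im (A i j) ^+ 2)).

Definition polarC (d : nat) (Y : 'M[R[i]]_d) : 'M[R[i]]_d :=
  xget 0 [set Z | unitaryC Z /\
                  forall Z', unitaryC Z' -> frobC (Z - Y) <= frobC (Z' - Y)].

Definition sv_sumC (d : nat) (G : 'M[R[i]]_d) : R :=
  \sum_j (xget 0 [set s : 'rV[R]_d | (forall j, 0 <= s 0 j) /\
             exists U V : 'M[R[i]]_d, unitaryC U /\ unitaryC V /\
                G = U *m diag_mx (\row_j Complex (s 0 j) 0) *m ctr V]) 0 j.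

Definition alphaC (d : nat) : \bar R :=
  gaussC_E d d (d%:R^-1)%R (fun G => d%:R^-1 * sv_sumC G)%R.

Definition blkC (n d : nat) (C : 'M[R[i]]_(n * d)) (i j : 'I_n) : 'M[R[i]]_d :=
  \matrix_(a, b) C (bidx i a) (bidx j b).

Definition objC (n d k : nat) (C : 'M[R[i]]_(n * d)) (V : 'I_n -> 'M[R[i]]_(d, k))
  : R[i] :=
  \sum_i \sum_j \tr (ctr (blkC C i j) *m V i *m ctr (V j)).

Definition herm_psd (N : nat) (C : 'M[R[i]]_N) : Prop :=
  ctr C = C /\ forall v : 'cV[R[i]]_N, 0 <= (ctr v *m C *m v) 0 0.

End Defs.

Arguments gaussR_E {R} m k s f.
Arguments gaussC_E {R} m k t f.
Arguments alphaR R d : clear implicits.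
Arguments alphaC R d : clear implicits.

(* Main.v *)
Require Import Defs.
From HB Require Import structures.
From mathcomp Require Import all_boot all_order all_algebra.
From mathcomp Require Import all_classical all_reals all_analysis.
From mathcomp Require Import measurable_realfun complex.
From mathcomp Require Import ring lra.
Set Implicit Arguments. Unset Strict Implicit. Unset Printing Implicit Defensive.
Import Order.TTheory GRing.Theory Num.Theory.
Import numFieldNormedType.Exports.
Local Open Scope classical_set_scope.
Local Open Scope ring_scope.

(* Write phi M for the nuclear norm, i.e. the maximum of Re tr(Z M^* ) over
   orthogonal (unitary) Z, attained at the polar factor of M. By positivity of C
   at V - a X R, the objective at V_i = P(X_i R) is at least
   2a sum_i <V_i, B_i R> - a^2 obj(X R), where B = C X, and since V_i is a
   subgradient of phi at X_i R,
     t <V_i, B_i R> >= phi(X_i R) - phi((X_i - t B_i) R).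
   This minorant is continuous in R, so neither the measurability of the polar
   factor nor its choice at singular matrices matters: nonnegative integrals are
   monotone without measurability. Its expectation is controlled by
     E phi(A R) <= (|A|^2 / d + 1) / 2 * E phi(G),   G a d x d Gaussian matrix,
   which holds because A R has the law of S G with S S^* = A A^*, because
   2 phi(S G) <= tr(S H S^* ) + tr H with H = G P(G)^*, and because averaging over
   signed cyclic permutations of the rows of G replaces H by (tr H / d) I. Taking
   a = E phi(G) / d and letting t -> 0 yields a^2 obj(X). Finally, alpha(d) <= a,
   whatever the singular values chosen by [sv_sumR] and [sv_sumC].
   The real and complex cases are treated at once over a field with involution. *)

(** * Gaussian integrals on the line and in the plane *)

(** The direct route would evaluate E <V_i, B_i R> by Gaussian symmetry as a multiple of <X_i, B_i>.
    This needs V_i to be measurable and equivariant, which an arbitrary choice of polar factor does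
    not provide. Comparing phi at X_i R and at (X_i - t B_i) R avoids it: apart from quadratic
    forms, only phi, a Lipschitz function, is integrated exactly. The factor (|A|^2 / d + 1) / 2 is
    the tangent at |A|^2 = d of the square root of |A|^2 / d. It is exact at A = X_i, and along -B_i
    it decreases to first order by t <X_i, B_i> / d. With E obj(X R) <= obj(X), the resulting bound
    is (2 a E phi(G) / d - a^2) obj(X) up to O(t), and a = E phi(G) / d maximises it. The minorant
    can be negative, whereas the final comparison is between nonnegative functions; so its positive
    part is integrated. The relaxation enters only at the end: orthogonal or unitary matrices padded
    with zero columns are feasible for it. *)

Section Integral.
Local Open Scope ereal_scope.

(** The integral of a nonnegative function is the supremum over the simple functions below it, and a
    larger function has more of them. *)
Lemma ge0_le_integral_nonmeas d (T : measurableType d) (R : realType)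
    (mu : {measure set T -> \bar R}) (f g : T -> \bar R) :
  (forall x, 0 <= f x) -> (forall x, f x <= g x) ->
  \int[mu]_x f x <= \int[mu]_x g x.
Proof.
move=> f0 fg; have g0 x : 0 <= g x by exact: le_trans (f0 x) (fg x).
rewrite !ge0_integralTE//; apply: ereal_sup_le => _ [h hf <-].
by exists h => // x; exact: le_trans (hf x) (fg x).
Qed.

Import HBNNSimple.

(** By monotone convergence both sides are limits along the same increasing simple functions. For
    these the claim is checked level set by level set, where it is the hypothesis on [nu]. *)
Lemma ge0_integral_density d (T : measurableType d) (R : realType)
    (nu mu : {measure set T -> \bar R}) (g : T -> R) (f : T -> \bar R) :
  measurable_fun setT g -> (forall x, (0 <= g x)%R) ->
  (forall A, measurable A -> nu A = \int[mu]_(x in A) (g x)%:E) ->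
  measurable_fun setT f -> (forall x, 0 <= f x) ->
  \int[nu]_x f x = \int[mu]_x (f x * (g x)%:E).
Proof.
move=> mg g0 nuE mf f0.
have mge : measurable_fun setT (EFin \o g) by exact/measurable_EFinP.
pose h := nnsfun_approx measurableT mf.
have -> : \int[nu]_x f x = lim (\int[nu]_x (EFin \o h n) x @[n --> \oo]).
  have fE x : f x = lim ((EFin \o h n) x @[n --> \oo]).
    by apply/esym/cvg_lim => //; exact: cvg_nnsfun_approx.
  under eq_integral => x _ do rewrite fE.
  apply: monotone_convergence => //.
  - by move=> n; exact/measurable_EFinP.
  - by move=> n x Ex //=; rewrite lee_fin.
  - by move=> x Ex a b ab; rewrite lee_fin; exact/lefP/nd_nnsfun_approx.
have -> : \int[mu]_x (f x * (g x)%:E) =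
    lim (\int[mu]_x (((EFin \o h n) x) * (g x)%:E) @[n --> \oo]).
  have fg x : f x * (g x)%:E = lim ((((EFin \o h n) x) * (g x)%:E) @[n --> \oo]).
    by apply/esym/cvg_lim => //; apply: cvgeZr => //; exact: cvg_nnsfun_approx.
  under eq_integral => x _ do rewrite fg.
  apply: monotone_convergence => [//| | |].
  - by move=> n; apply/emeasurable_funM => //; exact/measurable_EFinP.
  - by move=> n x Ex /=; rewrite mule_ge0 ?lee_fin ?g0.
  - move=> x Ex a b ab/=; rewrite lee_wpmul2r ?lee_fin ?g0//.
    exact/lefP/nd_nnsfun_approx.
suff suf n : \int[mu]_x ((EFin \o h n) x * (g x)%:E) =
    \int[nu]_x (EFin \o h n) x.
  by under [in RHS]eq_fun do rewrite suf.
transitivity (\int[nu]_x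
   (\sum_(y \in range (h n)) (y * \1_(h n @^-1` [set y]) x)%:E)); last first.
  by apply: eq_integral => t tE; rewrite /= fimfunE -fsumEFin.
have indich m r : measurable_fun setT (fun x => (r * \1_(h m @^-1` [set r]) x)%:E).
  by apply: (measurable_comp measurableT) => //; exact: measurable_funM.
rewrite ge0_integral_fsum//; last by move=> m y Ey; exact: nnfun_muleindic_ge0.
transitivity (\int[mu]_x (\sum_(y \in range (h n))
    (y * \1_(h n @^-1` [set y]) x)%:E * (g x)%:E)).
  under [RHS]eq_integral => x xE.
    rewrite -ge0_mule_fsuml => [|y]; last exact: nnfun_muleindic_ge0.
    rewrite fsumEFin // -(fimfunE _ x); over.
  by [].
rewrite ge0_integral_fsum//; last 2 first.
  - by move=> y; apply: emeasurable_funM.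
  - move=> m y Ey; apply: mule_ge0; last by rewrite lee_fin g0.
    exact: nnfun_muleindic_ge0.
apply: eq_fsbigr => r rhn.
under [RHS]eq_integral do rewrite EFinM.
rewrite integralZl_indic_nnsfun => //.
under eq_integral do rewrite EFinM -muleA.
rewrite ge0_integralZl//.
- under eq_integral do rewrite muleC.
  rewrite (eq_integral ((EFin \o g) \_ (h n @^-1` [set r]))); last first.
    by move=> x xE; rewrite epatch_indic.
  by rewrite -integral_mkcondr setTI -nuE// integral_indic// setIT.
- by apply: emeasurable_funM => //; exact/measurable_EFinP.
- by move=> t Et; rewrite mule_ge0 ?lee_fin ?g0.
- by move: rhn; rewrite inE => -[t _ <-]; rewrite lee_fin.
Qed.

Variable R : realType.
Notation mu := (@lebesgue_measure R).

Lemma ge0_integral_normal_prob (m s : R) (f : measurableTypeR R -> \bar R) :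
  measurable_fun setT f -> (forall x, 0 <= f x) ->
  \int[normal_prob m s]_x f x = \int[mu]_x (f x * (normal_pdf m s x)%:E).
Proof.
move=> mf f0; apply: ge0_integral_density => //.
- exact: measurable_normal_pdf.
- exact: normal_pdf_ge0.
Qed.

(** Lebesgue measure equals |a| times its image under the affine map: the two agree on half-open
    intervals, which determine it. *)
Lemma ge0_integral_affine (a b : R) (f : measurableTypeR R -> \bar R) : (a != 0)%R ->
  measurable_fun setT f -> (forall x, 0 <= f x) ->
  \int[mu]_x f (a * x + b)%R = (`|a|^-1)%:E * \int[mu]_x f x.
Proof.
move=> a0 mf f0.
have maff : measurable_fun setT
    ((fun x => a * x + b)%R : measurableTypeR R -> measurableTypeR R).
  by apply: measurable_funD => //; exact: measurable_funM.
pose aff := (fun x => a * x + b)%R : measurableTypeR R -> measurableTypeR R.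
have a1 : (0 <= `|a|)%R by [].
pose nu0 : {measure set (measurableTypeR R) -> \bar R} :=
  measure_function_pushforward__canonical__measure_function_Measure mu maff.
pose nu : {measure set (measurableTypeR R) -> \bar R} := mscale (NngNum a1) nu0.
have nuE : forall A, measurable A -> mu A = nu A.
  apply: lebesgue_measure_unique => _ [[p q] _ <-] /=.
  rewrite /mscale /= /pushforward.
  have [ap|an|ae] := ltgtP 0%R a; last by rewrite -ae eqxx in a0.
  - rewrite (_ : _ @^-1` _ = `]((p - b) / a)%R, ((q - b) / a)%R]%classic); last first.
      apply/seteqP; split => x /=; rewrite !in_itv/= ltr_pdivrMr// ler_pdivlMr//.
        by rewrite (mulrC x) ltrBlDr lerBrDr.
      by rewrite (mulrC x) ltrBlDr lerBrDr.
    rewrite !lebesgue_measure_itv/= !lte_fin ltr_pM2r ?invr_gt0// ltrD2r.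
    case: ifP => pq; last by rewrite mule0.
    rewrite -!EFinB -EFinM; congr EFin; rewrite ger0_norm ?ltW//.
    by field.
  (* A negative slope reverses the interval, so the closed end changes side; the length is
     unaffected. *)
  - rewrite (_ : _ @^-1` _ = `[((q - b) / a)%R, ((p - b) / a)%R[%classic); last first.
      apply/seteqP; split => x /=; rewrite !in_itv/= ltr_ndivlMr// ler_ndivrMr//.
        by rewrite (mulrC x) ltrBlDr lerBrDr andbC.
      by rewrite (mulrC x) ltrBlDr lerBrDr andbC.
    rewrite !lebesgue_measure_itv/= !lte_fin ltr_nM2r ?invr_lt0// ltrD2r.
    case: ifP => pq; last by rewrite mule0.
    rewrite -!EFinB -EFinM; congr EFin; rewrite ler0_norm ?ltW//.
    by field.
have -> : \int[mu]_x f x = \int[nu]_x f x.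
  by apply: eq_measure_integral => A mA _; exact: nuE.
rewrite ge0_integral_mscale//= ge0_integral_pushforward//= muleA -EFinM.
by rewrite mulVf ?normr_eq0// mul1e.
Qed.
End Integral.

Section Gaussian.
Variable R : realType.
Notation mu := (@lebesgue_measure R).
Notation T := (measurableTypeR R).

Section Plane.
Local Open Scope ereal_scope.

Lemma ge0_integral_swap (f : T -> T -> \bar R) :
  measurable_fun setT (fun z : T * T => f z.1 z.2) -> (forall x y, 0 <= f x y) ->
  \int[mu]_x \int[mu]_y f x y = \int[mu]_y \int[mu]_x f x y.
Proof.
by move=> mf f0; exact: (@fubini_tonelli _ _ _ _ _ mu mu _ mf (fun z => f0 _ _)).
Qed.

(** The rotation is undone one variable at a time. For [c != 0], substituting u = c x - s y for x
    turns the second argument into (s u + y) / c, and then y is substituted; the Jacobians 1/|c| and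
    |c| cancel. For [c = 0] the map exchanges the axes up to sign. *)
Lemma ge0_integral_rotation (c s : R) (k : T * T -> \bar R) :
  (c ^+ 2 + s ^+ 2 = 1)%R -> measurable_fun setT k -> (forall z, 0 <= k z) ->
  \int[mu]_x \int[mu]_y k (c * x - s * y, s * x + c * y)%R =
  \int[mu]_x \int[mu]_y k (x, y).
Proof.
move=> cs mk k0.
have mpair (a b a' b' : R) : measurable_fun [set: T * T]
    (fun z => k (a * z.1 + b * z.2, a' * z.1 + b' * z.2)%R).
  apply: measurableT_comp => //; apply: measurable_fun_pair => //=;
    by apply: measurable_funD => //; exact: measurable_funM.
have [c0|c0] := eqVneq c 0%R.
  move: cs; rewrite c0 expr0n/= add0r => s1.
  have s0 : (s != 0)%R.
    by apply/eqP => s0; move: s1; rewrite s0 expr0n/= => /eqP; rewrite eq_sym oner_eq0.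
  have sn : `|s|%R = 1%R.
    by apply/eqP; rewrite -(@eqrXn2 _ 2)// ?expr1n -?normrX ?s1 ?normr1.
  have m1 x : measurable_fun setT (fun u : T => k (u, (s * x)%R)).
    by apply: measurableT_comp => //; exact: measurable_fun_pair.
  transitivity (\int[mu]_x \int[mu]_u k (u, s * x)%R).
    apply: eq_integral => x _.
    transitivity (\int[mu]_y (fun u : T => k (u, s * x)%R) (- s * y + 0)%R).
      by apply: eq_integral => y _ /=; rewrite !mul0r !addr0 mulNr sub0r.
    by rewrite (ge0_integral_affine _ _ (m1 x)) ?oppr_eq0// normrN sn invr1 mul1e.
  etransitivity.
    apply: (@ge0_integral_swap (fun x u => k (u, s * x)%R)) => //.
    have := mpair 0%R 1%R s 0%R; apply: eq_measurable_fun => z _ /=.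
    by rewrite !mul0r mul1r add0r addr0.
  apply: eq_integral => u _.
  transitivity (\int[mu]_y (fun v : T => k (u, v)%R) (s * y + 0)%R).
    by apply: eq_integral => y _ /=; rewrite addr0.
  rewrite (@ge0_integral_affine _ _ _ (fun v : T => k (u, v)))//.
    by rewrite sn invr1 mul1e.
  exact: measurableT_comp.
etransitivity.
  apply: (@ge0_integral_swap (fun x y => k (c * x - s * y, s * x + c * y)%R)) => //.
  by have := mpair c (- s)%R s c; apply: eq_measurable_fun => z _ /=; rewrite mulNr.
have mq : measurable_fun setT (fun z : T * T => k (z.1, s / c * z.1 + c^-1 * z.2)%R).
  have := mpair 1%R 0%R (s / c)%R c^-1%R; apply: eq_measurable_fun => z _ /=.
  by rewrite mul0r addr0 mul1r.
transitivity (\int[mu]_y ((`|c|^-1)%:E * \int[mu]_u k (u, s / c * u + c^-1 * y)%R)).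
  apply: eq_integral => y _.
  rewrite -(@ge0_integral_affine _ c (- s * y)%R
    (fun u : T => k (u, s / c * u + c^-1 * y)%R))//; last first.
    exact: (measurable_fun_pair1 y mq).
  apply: eq_integral => x _ /=; congr (k (_, _)%R); first by rewrite mulNr.
  by rewrite -[X in (_ + c^-1 * X)%R]mul1r -cs; field.
rewrite ge0_integralZl//; last 2 first.
  - have /= := @measurable_fun_fubini_tonelli_G _ _ T T R mu _ mq _.
    by apply => // x.
  - by move=> y _; exact: integral_ge0.
rewrite -(@ge0_integral_swap (fun u y => k (u, s / c * u + c^-1 * y)%R))//.
rewrite -ge0_integralZl//; last 2 first.
  - exact: (@measurable_fun_fubini_tonelli_F _ _ T T R mu _ mq).
  - by move=> y _; exact: integral_ge0.
apply: eq_integral => u _.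
transitivity ((`|c|^-1)%:E * \int[mu]_y (fun v : T => k (u, v)) (c^-1 * y + s / c * u)%R).
  by congr (_ * _); apply: eq_integral => y _ /=; rewrite addrC.
rewrite (@ge0_integral_affine _ _ _ (fun v : T => k (u, v))) ?invr_eq0//;
  last exact: measurableT_comp.
by rewrite muleA -EFinM normfV invrK mulVf ?normr_eq0// mul1e.
Qed.

Variable s : R.
Hypothesis s0 : s != 0%R.
Notation gam := (normal_prob 0 s).

(** The product density depends on x^2 + y^2 only. *)
Lemma normal_pdf_rotation (a b x y : R) : (a ^+ 2 + b ^+ 2 = 1)%R ->
  (normal_pdf 0 s (a * x - b * y) * normal_pdf 0 s (b * x + a * y) =
   normal_pdf 0 s x * normal_pdf 0 s y)%R.
Proof.
move=> ab; rewrite !normal_pdfE// /normal_fun !subr0 mulrACA [RHS]mulrACA.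
congr (_ * _)%R; rewrite -!expRD; congr expR.
rewrite -!mulrDl; congr (_ / _)%R.
by rewrite -[in RHS](mul1r (x ^+ 2)%R) -(mul1r (y ^+ 2)%R) -ab; ring.
Qed.

Lemma normal_prob_rotation (a b : R) (k : T * T -> \bar R) :
  (a ^+ 2 + b ^+ 2 = 1)%R -> measurable_fun setT k -> (forall z, 0 <= k z) ->
  \int[gam]_x \int[gam]_y k (a * x - b * y, b * x + a * y)%R =
  \int[gam]_x \int[gam]_y k (x, y).
Proof.
move=> ab mk k0.
have mp := @measurable_normal_pdf R 0%R s.
have toLeb (h : T * T -> \bar R) : measurable_fun setT h -> (forall z, 0 <= h z) ->
   \int[gam]_x \int[gam]_y h (x, y) = \int[mu]_x \int[mu]_y
     (h (x, y) * (normal_pdf 0 s x * normal_pdf 0 s y)%R%:E).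
  move=> mh h0; rewrite ge0_integral_normal_prob//; last 2 first.
  - exact: (@measurable_fun_fubini_tonelli_F _ _ T T R gam _ mh).
  - by move=> x; exact: integral_ge0.
  apply: eq_integral => x _.
  have mhx : measurable_fun [set: T] (fun y => h (x, y)) by exact: measurableT_comp.
  rewrite ge0_integral_normal_prob// -ge0_integralZr//; last 3 first.
  - by apply: emeasurable_funM => //; exact/measurable_EFinP.
  - by move=> y _; rewrite mule_ge0 ?lee_fin ?normal_pdf_ge0.
  - by rewrite lee_fin normal_pdf_ge0.
  by apply: eq_integral => y _; rewrite -muleA -EFinM mulrC.
have mkr : measurable_fun [set: T * T]
    (fun z => k (a * z.1 - b * z.2, b * z.1 + a * z.2)%R).
  apply: (measurableT_comp mk); apply: measurable_fun_pair => //=.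
    by apply: measurable_funB; exact: measurable_funM.
  by apply: measurable_funD; exact: measurable_funM.
etransitivity; first by apply: (toLeb _ mkr) => z; exact: k0.
etransitivity; last by apply: esym; exact: (toLeb _ mk k0).
etransitivity; last first.
  apply: (@ge0_integral_rotation a b
    (fun z => k z * (normal_pdf 0 s z.1 * normal_pdf 0 s z.2)%R%:E)) => //.
- apply: emeasurable_funM => //; apply/measurable_EFinP.
  by apply: measurable_funM; exact: measurableT_comp.
- by move=> z; rewrite mule_ge0 ?lee_fin ?mulr_ge0 ?normal_pdf_ge0.
apply: eq_integral => x _; apply: eq_integral => y _ /=.
by rewrite normal_pdf_rotation.
Qed.

Lemma normal_prob_sym (f : T -> \bar R) : measurable_fun setT f ->
  (forall x, 0 <= f x) -> \int[gam]_x f (- x)%R = \int[gam]_x f x.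
Proof.
move=> mf f0; have mp := @measurable_normal_pdf R 0%R s.
rewrite !ge0_integral_normal_prob//; last exact: measurableT_comp.
have mfp : measurable_fun [set: T] (fun x => f x * (normal_pdf 0 s x)%:E).
  by apply: emeasurable_funM => //; exact/measurable_EFinP.
transitivity (\int[mu]_x
   (fun x => f x * (normal_pdf 0 s x)%:E) (-1 * x + 0)%R).
  apply: eq_integral => x _ /=; rewrite addr0 mulN1r.
  by rewrite normal_pdfE// /normal_fun !subr0 sqrrN.
rewrite (@ge0_integral_affine _ _ _ (fun x => f x * (normal_pdf 0 s x)%:E))//.
- by rewrite normrN normr1 invr1 mul1e.
- by move=> x; rewrite mule_ge0 ?lee_fin ?normal_pdf_ge0.
Qed.

(* Comparing the densities of N(0, s^2) and N(0, (r s)^2) through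
   1 + u <= expR u bounds the second moment for every r > 1. *)
Lemma normal_second_moment_aux (r : R) : (1 < r)%R ->
  \int[gam]_x (x ^+ 2)%:E <= (s ^+ 2 * (2 * r ^+ 2 / (r + 1)))%:E.
Proof.
move=> r1; have r0 : (0 < r)%R by lra.
have rs0 : (r * s)%R != 0%R by rewrite mulf_neq0// gt_eqF.
(* [kap] is the difference 1 / (2 s^2) - 1 / (2 r^2 s^2) of the two exponents. Integrating the
   pointwise bound gives 1 + kap E x^2 <= r, that is E x^2 <= (r - 1) / kap. *)
pose kap := ((r ^+ 2 - 1) / (2 * s ^+ 2 * r ^+ 2))%R.
have s20 : (0 < s ^+ 2)%R by rewrite exprn_even_gt0.
have kap0 : (0 < kap)%R.
  apply: divr_gt0; first nra.
  by apply: mulr_gt0; [apply: mulr_gt0|exact: exprn_gt0].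
have pw x : (normal_pdf 0 s x * (1 + kap * x ^+ 2) <= r * normal_pdf 0 (r * s) x)%R.
  rewrite !normal_pdfE// /normal_fun !subr0.
  have -> : normal_peak s = (r * normal_peak (r * s))%R.
    rewrite /normal_peak.
    have -> : ((r * s) ^+ 2 * pi *+ 2 = r ^+ 2 * (s ^+ 2 * pi *+ 2))%R by ring.
    by rewrite sqrtrM ?sqr_ge0// sqrtr_sqr gtr0_norm// invfM mulVKf ?gt_eqF.
  rewrite -[leLHS]mulrA -[leLHS]mulrA; apply: ler_wpM2l; first exact: ltW.
  apply: ler_wpM2l; first exact: normal_peak_ge0.
  rewrite [X in (_ <= expR X)%R](_ : _ = - x ^+ 2 / (s ^+ 2 *+ 2) + kap * x ^+ 2)%R.
    by rewrite expRD; apply: ler_wpM2l; [exact: expR_ge0|exact: expR_ge1Dx].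
  rewrite /kap -!(mulr_natl (_ ^+ 2)%R); field.
  by rewrite s0 gt_eqF.
have mp t : measurable_fun [set: T] (normal_pdf 0 t) by exact: measurable_normal_pdf.
have msq : measurable_fun [set: T] (fun x : T => (x ^+ 2)%:E).
  by apply/measurable_EFinP; exact: measurable_funX.
have msqp : measurable_fun [set: T] (fun x : T => (x ^+ 2)%:E * (normal_pdf 0 s x)%:E).
  by apply: emeasurable_funM => //; exact/measurable_EFinP.
have sq0 (x : T) : 0 <= (x ^+ 2)%:E by rewrite lee_fin sqr_ge0.
have sqp0 (x : T) : 0 <= (x ^+ 2)%:E * (normal_pdf 0 s x)%:E.
  by rewrite mule_ge0// lee_fin normal_pdf_ge0.
have key : 1 + kap%:E * \int[gam]_x (x ^+ 2)%:E <= r%:E.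
  rewrite ge0_integral_normal_prob// -(integral_normal_pdf 0 s) -ge0_integralZl//;
    last by rewrite lee_fin ltW.
  rewrite -ge0_integralD//; first last.
  - exact: measurable_funeM.
  - by move=> x _; rewrite mule_ge0// lee_fin ltW.
  - exact/measurable_EFinP.
  - by move=> x _; rewrite lee_fin normal_pdf_ge0.
  rewrite -[leRHS]mule1 -(integral_normal_pdf 0 (r * s)) -ge0_integralZl//; first last.
  - by rewrite lee_fin ltW.
  - by move=> x _; rewrite lee_fin normal_pdf_ge0.
  - exact/measurable_EFinP.
  apply: ge0_le_integral_nonmeas => x.
    by rewrite adde_ge0 ?mule_ge0// lee_fin ?normal_pdf_ge0// ltW.
  rewrite -!EFinM -EFinD lee_fin; apply: le_trans (pw x).
  by rewrite mulrDr mulr1 mulrA (mulrC (normal_pdf 0 s x)) mulrAC -mulrA.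
move: key; have : 0 <= \int[gam]_x (x ^+ 2)%:E by exact: integral_ge0.
case: (\int[gam]_x (x ^+ 2)%:E) => [E _||//].
  rewrite -EFinM -EFinD !lee_fin => E1.
  rewrite -(ler_pM2l kap0); apply: (@le_trans _ _ (r - 1)%R); first lra.
  rewrite [leRHS](_ : _ = r - 1)%R// /kap; field.
  by rewrite s0 !gt_eqF//; lra.
by rewrite mulry gtr0_sg// mul1e.
Qed.

Lemma normal_second_moment : \int[gam]_x (x ^+ 2)%:E <= (s ^+ 2)%:E.
Proof.
have s20 : (0 < s ^+ 2)%R by rewrite exprn_even_gt0.
apply/lee_addgt0Pr => e e0.
(* At r = 1 + t the previous bound exceeds s^2 by at most 2 t s^2, which this choice keeps below
   e. *)
pose t := Num.min 1%R (e / (s ^+ 2 * 2))%R.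
have t0 : (0 < t)%R by rewrite lt_min ltr01 divr_gt0// mulr_gt0.
have t1 : (t <= 1)%R by rewrite ge_min lexx.
have te : (s ^+ 2 * 2 * t <= e)%R.
  have h : (0 < s ^+ 2 * 2)%R by apply: mulr_gt0.
  rewrite [leLHS]mulrC -(ler_pdivlMr _ _ h).
  by rewrite ge_min lexx orbT.
apply: le_trans (@normal_second_moment_aux (1 + t)%R _) _; first lra.
rewrite -EFinD lee_fin.
have : (2 * (1 + t) ^+ 2 / (1 + t + 1) <= 1 + 2 * t)%R.
  by rewrite ler_pdivrMr; nra.
move/(ler_wpM2l (ltW s20)) => h; apply: le_trans h _.
by rewrite mulrDr mulr1 lerD2l mulrA.
Qed.

End Plane.

End Gaussian.

(** * Gaussian vectors and their rotation invariance *)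

Section GaussianVector.
Variables (R : realType) (s : R).
Notation T := (measurableTypeR R).
Notation gam := (normal_prob 0 s).

(** Row vectors let linear maps act by [*m]. Taking coordinate 0 outermost matches the block form
    [row_mx x%:M w], on which the inductions on the dimension run. *)
Fixpoint gE (N : nat) : ('rV[R]_N -> \bar R) -> \bar R :=
  match N with
  | 0 => fun F => F 0
  | N'.+1 => fun F =>
      (\int[gam]_x gE (fun w : 'rV_N' => F (row_mx x%:M w : 'rV_(1 + N'))))%E
  end.

(* Joint measurability in a parameter [y] and finitely many real coordinates,
   without putting a sigma-algebra on the space of row vectors. *)
Definition jmeas d (Y : measurableType d) N (F : Y -> 'rV[R]_N -> \bar R) :=
  forall d' (Z : measurableType d') (g : Z -> Y) (h : 'I_N -> Z -> T),
    measurable_fun setT g -> (forall i, measurable_fun setT (h i)) ->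
    measurable_fun setT (fun z => F (g z) (\row_i h i z)).

Definition cmeas N (F : 'rV[R]_N -> \bar R) :=
  forall d (Z : measurableType d) (h : 'I_N -> Z -> T),
    (forall i, measurable_fun setT (h i)) ->
    measurable_fun setT (fun z => F (\row_i h i z)).

Lemma jmeas_row_mx d (Y : measurableType d) N (F : Y -> 'rV[R]_(1 + N) -> \bar R) :
  jmeas F -> jmeas (fun (p : Y * T) w => F p.1 (row_mx p.2%:M w)).
Proof.
move=> mF d' Z g h mg mh.
pose h' (i : 'I_(1 + N)) z : T := match fintype.split i with
  | inl _ => (g z).2 | inr j => h j z end.
have -> : (fun z => F (g z).1 (row_mx (g z).2%:M (\row_i h i z))) =
    (fun z => F (g z).1 (\row_i h' i z)).
  apply/funext => z; congr F; apply/rowP => i; rewrite !mxE /h'.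
  by case: fintype.split => j; rewrite !mxE// ord1 eqxx.
apply: mF; first exact: measurableT_comp.
move=> i; rewrite /h'; case: fintype.split => [_|j]; first exact: measurableT_comp.
exact: mh.
Qed.

Lemma gE_ge0 N (F : 'rV[R]_N -> \bar R) : (forall w, 0 <= F w)%E -> (0 <= gE F)%E.
Proof.
by elim: N F => [|N IH] F F0 /=; [exact: F0|apply: integral_ge0 => x _; exact: IH].
Qed.

(** The induction moves the outermost coordinate into the parameter, from Y to Y * R, and Tonelli
    integrates it out; hence the general parameter space in [jmeas]. *)
Lemma measurable_gE N d (Y : measurableType d) (F : Y -> 'rV[R]_N -> \bar R) :
  jmeas F -> (forall y w, (0 <= F y w)%E) -> measurable_fun setT (fun y => gE (F y)).
Proof.
elim: N d Y F => [|N IH] d Y F mF F0 /=.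
  have := mF _ Y id (fun i _ => 0) (@measurable_id _ _ _) (fun i => measurable_cst _).
  by apply: eq_measurable_fun => y _; rewrite [X in F _ X]thinmx0.
have := IH _ _ _ (jmeas_row_mx mF) (fun p w => F0 _ _).
move=> /(@measurable_fun_fubini_tonelli_F _ _ Y T R gam); apply => p.
exact: gE_ge0.
Qed.

Lemma gE_le N (F G : 'rV[R]_N -> \bar R) :
  (forall w, 0 <= F w)%E -> (forall w, F w <= G w)%E -> (gE F <= gE G)%E.
Proof.
elim: N F G => [|N IH] F G F0 FG /=; first exact: FG.
by apply: ge0_le_integral_nonmeas => x; [exact: gE_ge0|exact: IH].
Qed.

Lemma gE_cst N (c : \bar R) : gE (fun _ : 'rV[R]_N => c) = c.
Proof.
elim: N => [//|N IH] /=; under eq_integral do rewrite IH.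
etransitivity; first exact: (@integral_cst _ _ _ gam setT measurableT c).
by rewrite -[RHS]mule1; congr (_ * _)%E; exact: probability_setT.
Qed.

Lemma cmeas_row_mx N (F : 'rV[R]_(1 + N) -> \bar R) : cmeas F ->
  jmeas (fun (x : T) w => F (row_mx x%:M w)).
Proof.
move=> mF d' Z g h mg mh.
by apply: (@jmeas_row_mx _ T N (fun _ => F) _ _ Z (fun z => (g z, g z))) => //;
  [move=> ? ? ? ? _; exact: mF|exact: measurable_fun_pair].
Qed.

Lemma cmeas_section N (F : 'rV[R]_(1 + N) -> \bar R) (x : R) : cmeas F ->
  cmeas (fun w => F (row_mx x%:M w)).
Proof.
move=> mF d Z h mh; exact: (@cmeas_row_mx _ _ mF _ Z (fun _ => x) h).
Qed.

Lemma measurable_gE_section N (F : 'rV[R]_(1 + N) -> \bar R) :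
  cmeas F -> (forall w, (0 <= F w)%E) ->
  measurable_fun setT (fun x : T => gE (fun w => F (row_mx x%:M w))).
Proof. by move=> mF F0; apply: measurable_gE; first exact: cmeas_row_mx. Qed.

Lemma gE_add N (F G : 'rV[R]_N -> \bar R) : cmeas F -> cmeas G ->
  (forall w, 0 <= F w)%E -> (forall w, 0 <= G w)%E ->
  gE (fun w => F w + G w)%E = (gE F + gE G)%E.
Proof.
elim: N F G => [//|N IH] F G mF mG F0 G0 /=.
etransitivity.
  by apply: eq_integral => x _; apply: IH => //; exact: cmeas_section.
apply: ge0_integralD => //; do ?[by move=> x _; exact: gE_ge0];
  exact: measurable_gE_section.
Qed.

Lemma gE_scale N (c : R) (F : 'rV[R]_N -> \bar R) : 0 <= c -> cmeas F ->
  (forall w, 0 <= F w)%E -> gE (fun w => c%:E * F w)%E = (c%:E * gE F)%E.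
Proof.
move=> c0; elim: N F => [//|N IH] F mF F0 /=.
etransitivity.
  by apply: eq_integral => x _; apply: IH => //; exact: cmeas_section.
apply: ge0_integralZl => //; do ?[by move=> x _; exact: gE_ge0];
  exact: measurable_gE_section.
Qed.

Lemma cmeas_cst N (c : \bar R) : cmeas (fun _ : 'rV[R]_N => c).
Proof. by move=> d Z h mh; exact: measurable_cst. Qed.

Lemma cmeas_add N (F G : 'rV[R]_N -> \bar R) : cmeas F -> cmeas G ->
  cmeas (fun w => F w + G w)%E.
Proof. by move=> mF mG d Z h mh; apply: emeasurable_funD; [exact: mF|exact: mG]. Qed.

Lemma cmeas_mul N (F G : 'rV[R]_N -> \bar R) : cmeas F -> cmeas G ->
  cmeas (fun w => F w * G w)%E.
Proof. by move=> mF mG d Z h mh; apply: emeasurable_funM; [exact: mF|exact: mG]. Qed.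

Lemma cmeas_coord N i : cmeas (fun w : 'rV[R]_N => (w 0 i)%:E).
Proof.
move=> d Z h mh; apply/measurable_EFinP; have := mh i.
by apply: eq_measurable_fun => z _; rewrite mxE.
Qed.

Lemma cmeas_sum N I (r : seq I) (F : I -> 'rV[R]_N -> \bar R) :
  (forall i, cmeas (F i)) -> cmeas (fun w => \sum_(i <- r) F i w)%E.
Proof.
move=> mF; elim: r => [|i r IH].
  by move=> d Z h mh; under eq_fun do rewrite big_nil; exact: measurable_cst.
move=> d Z h mh; under eq_fun do rewrite big_cons.
by apply: emeasurable_funD; [exact: mF|exact: IH].
Qed.

Lemma cmeas_lin N p (F : 'rV[R]_p -> \bar R) (L : 'M[R]_(N, p)) : cmeas F ->
  cmeas (fun w => F (w *m L)).
Proof.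
move=> mF d Z h mh.
pose h' j z : T := \sum_i h i z * L i j.
have -> : (fun z => F (\row_i h i z *m L)) = (fun z => F (\row_j h' j z)).
  apply/funext => z; congr F; apply/rowP => j; rewrite !mxE.
  by apply: eq_bigr => i _; rewrite mxE.
apply: mF => j; apply: measurable_sum => i; apply: measurable_funM => //; exact: mh.
Qed.

Lemma gE_sum N I (r : seq I) (F : I -> 'rV[R]_N -> \bar R) :
  (forall i, cmeas (F i)) -> (forall i w, 0 <= F i w)%E ->
  gE (fun w => \sum_(i <- r) F i w)%E = (\sum_(i <- r) gE (F i))%E.
Proof.
move=> mF F0; elim: r => [|i r IH].
  rewrite big_nil -[RHS](gE_cst N); congr gE; apply/funext => w; exact: big_nil.
rewrite big_cons -IH -gE_add//; last 2 first.
- exact: cmeas_sum.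
- by move=> w; exact: sume_ge0.
by congr gE; apply/funext => w; rewrite big_cons.
Qed.

End GaussianVector.

(** * Orthogonal matrices: reflections, plane rotations and completion of isometries *)

Section Orthogonal.
Variable R : realType.

Lemma rV_sqE N (u : 'rV[R]_N) : (u *m u^T) 0 0 = \sum_i u 0 i ^+ 2.
Proof. by rewrite mxE; apply: eq_bigr => i _; rewrite mxE -expr2. Qed.

Lemma rV_sq_ge0 N (u : 'rV[R]_N) : 0 <= (u *m u^T) 0 0.
Proof. by rewrite rV_sqE sumr_ge0// => i _; exact: sqr_ge0. Qed.

Lemma rV_sq_eq0 N (u : 'rV[R]_N) : (u *m u^T) 0 0 = 0 -> u = 0.
Proof.
rewrite rV_sqE => /eqP; rewrite psumr_eq0; last by move=> i _; exact: sqr_ge0.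
move=> /allP u0; apply/rowP => i; rewrite mxE.
by have := u0 i (mem_index_enum _); rewrite sqrf_eq0 => /eqP.
Qed.

(** Distinct unit vectors are exchanged by the reflection in the hyperplane orthogonal to their
    difference. *)
Lemma householder N (v e : 'rV[R]_N) : v *m v^T = 1%:M -> e *m e^T = 1%:M ->
  exists Q : 'M[R]_N, Q *m Q^T = 1%:M /\ e *m Q = v.
Proof.
move=> vv ee; have [->|ve] := eqVneq v e.
  by exists 1%:M; rewrite trmx1 !mulmx1.
pose u := v - e; have uE : u = v - e by []; clearbody u; pose n2 := (u *m u^T) 0 0.
have n20 : n2 != 0 by apply: contra ve => /eqP/rV_sq_eq0/eqP; rewrite uE subr_eq0.
have uuE : u *m u^T = n2%:M by exact: mx11_scalar.
pose c := (e *m u^T) 0 0.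
have euE : e *m u^T = c%:M by exact: mx11_scalar.
(* As |v| = |e|, 2 <e, v - e> = - |v - e|^2; so the reflection adds exactly u to e. *)
have cE : c *+ 2 = - n2.
  have veE : v *m e^T = ((v *m e^T) 0 0)%:M by exact: mx11_scalar.
  have evE : e *m v^T = (v *m e^T)^T by rewrite trmx_mul trmxK.
  rewrite /n2 /c uE linearB/= !(mulmxBl, mulmxBr) vv ee evE veE tr_scalar_mx.
  by rewrite !mxE eqxx/= !mulr1n; ring.
pose Q := 1%:M - (2 / n2) *: (u^T *m u).
exists Q; split.
  have -> : Q^T = Q.
    by rewrite /Q linearB/= trmx1 linearZ/= trmx_mul trmxK.
  rewrite /Q mulmxBl mul1mx mulmxBr mulmx1 -scalemxAl -scalemxAr.
  rewrite mulmxA -(mulmxA u^T) uuE mul_mx_scalar -scalemxAl !scalerA.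
  rewrite opprB addrA -[RHS]addr0 -!addrA; congr (_ + _).
  rewrite -scaleNr -!scalerDl.
  rewrite [X in X *: _](_ : _ = 0) ?scale0r//; field.
  exact: n20.
rewrite /Q mulmxBr mulmx1 -scalemxAr mulmxA euE mul_scalar_mx scalerA.
rewrite [X in X *: _](_ : _ = -1).
  by rewrite scaleN1r opprK uE addrC subrK.
by rewrite mulrAC -(mulr_natl c 2) in cE *; rewrite cE mulNr divff.
Qed.

Definition diag1 N (Q : 'M[R]_N) : 'M[R]_(1 + N) := block_mx 1%:M 0 0 Q.

Lemma diag1_orth N (Q : 'M[R]_N) : Q *m Q^T = 1%:M -> diag1 Q *m (diag1 Q)^T = 1%:M.
Proof.
move=> QQ; rewrite /diag1 tr_block_mx mulmx_block !trmx0 !trmx1 !(mulmx0, mul0mx) QQ.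
by rewrite mulmx1 !addr0 add0r -scalar_mx_block.
Qed.

Lemma row_mx_diag1 N (x : 'M[R]_1) (w : 'rV[R]_N) Q :
  row_mx x w *m diag1 Q = row_mx x (w *m Q).
Proof. by rewrite /diag1 mul_row_block !mulmx0 mulmx1 addr0 add0r. Qed.

Lemma diag1_block N p (Q : 'M[R]_N) (L : 'M[R]_(N, p)) :
  diag1 Q *m block_mx 1%:M 0 0 L = block_mx 1%:M 0 0 (Q *m L) :> 'M[R]_(1 + N, 1 + p).
Proof.
by rewrite /diag1 mulmx_block !(mulmx0, mul0mx) mulmx1 !addr0 add0r.
Qed.

(** The rotation of the first two coordinates, in the form in which [normal_prob_rotation] uses it;
    see [row_mx_rot1]. *)
Definition rot1 N (c s : R) : 'M[R]_(1 + (1 + N)) :=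
  block_mx c%:M (row_mx s%:M 0) (col_mx (- s)%:M 0) (block_mx c%:M 0 0 1%:M).

Lemma row_mx_rot1 N (c s x y : R) (w : 'rV[R]_N) :
  row_mx x%:M (row_mx y%:M w) *m rot1 N c s =
  row_mx (c * x - s * y)%:M (row_mx (s * x + c * y)%:M w).
Proof.
rewrite /rot1 mul_row_block mul_row_col mul_row_block mul_mx_row add_row_mx.
have D (a b : R) : (a%:M + b%:M = (a + b)%:M :> 'M[R]_1) by rewrite raddfD.
rewrite !mulmx0 !addr0 !add0r mulmx1 -!scalar_mxM !D.
by congr (row_mx _%:M (row_mx _%:M _)); ring.
Qed.

Lemma rot1_orth N (c s : R) : c ^+ 2 + s ^+ 2 = 1 ->
  rot1 N c s *m (rot1 N c s)^T = 1%:M.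
Proof.
move=> cs.
have -> : (rot1 N c s)^T = rot1 N c (- s).
  rewrite /rot1 tr_block_mx tr_row_mx tr_col_mx tr_block_mx.
  by rewrite !tr_scalar_mx !trmx0 opprK.
apply/row_matrixP => i; rewrite !rowE mulmx1 mulmxA.
move: (delta_mx _ _) => u; rewrite -(hsubmxK u) -(hsubmxK (rsubmx u)).
rewrite [lsubmx u]mx11_scalar [lsubmx (rsubmx u)]mx11_scalar !row_mx_rot1.
congr (row_mx _%:M (row_mx _%:M _)); move: (lsubmx _ _ _) (lsubmx _ _ _) => x y.
  by rewrite -[RHS]mul1r -cs; ring.
by rewrite -[RHS]mul1r -cs; ring.
Qed.

(** If the first basis row is fixed by Q, its transpose is fixed by Q as well, so both off-diagonal
    blocks vanish. *)
Lemma orth_diag1 N (Q : 'M[R]_(1 + N)) : Q *m Q^T = 1%:M ->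
  row_mx 1%:M 0 *m Q = row_mx 1%:M 0 ->
  exists2 Q' : 'M[R]_N, Q' *m Q'^T = 1%:M & Q = diag1 Q'.
Proof.
move=> QQ eQ.
have QtQ : Q^T *m Q = 1%:M by exact: mulmx1C.
have Qe : Q *m (row_mx 1%:M 0)^T = (row_mx 1%:M 0)^T.
  by rewrite -{1}eQ trmx_mul mulmxA QQ mul1mx.
move: eQ Qe QQ; rewrite -(submxK Q) mul_row_block !mul1mx !mul0mx !addr0.
move=> /eq_row_mx[-> ->]; rewrite tr_row_mx trmx1 trmx0 mul_block_col.
rewrite !mulmx1 !mulmx0 !addr0 => /eq_col_mx[_ ->].
rewrite tr_block_mx mulmx_block !trmx0 !trmx1 !(mulmx0, mul0mx) mulmx1 !addr0 !add0r.
rewrite [RHS]scalar_mx_block => /eq_block_mx[_ _ _ QQ].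
by exists (drsubmx Q).
Qed.

(** An Euler angle decomposition: it reduces invariance under an orthogonal group to plane rotations
    and the group one dimension lower. If the first row of Q is (c, u) with |u| = s, a rotation
    followed by a map of the last coordinates already produces this row; the remaining factor of Q
    fixes the first basis vector. *)
Lemma orth_decomp N (Q : 'M[R]_(1 + (1 + N))) : Q *m Q^T = 1%:M ->
  exists Q1 Q2 : 'M[R]_(1 + N), exists c s : R,
    [/\ Q1 *m Q1^T = 1%:M, Q2 *m Q2^T = 1%:M, c ^+ 2 + s ^+ 2 = 1 &
        Q = diag1 Q1 *m (rot1 N c s *m diag1 Q2)].
Proof.
move=> QQ; pose e : 'rV[R]_(1 + (1 + N)) := row_mx 1%:M 0.
have ee M : (row_mx 1%:M 0 : 'rV[R]_(1 + M)) *m (row_mx 1%:M 0)^T = 1%:M.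
  by rewrite tr_row_mx mul_row_col trmx1 mulmx1 trmx0 mulmx0 addr0.
pose v := e *m Q.
have vv : v *m v^T = 1%:M by rewrite trmx_mul mulmxA -(mulmxA e) QQ mulmx1 ee.
pose c := lsubmx v 0 0; pose u := rsubmx v.
have vE : v = row_mx c%:M u by rewrite -mx11_scalar hsubmxK.
pose s := Num.sqrt ((u *m u^T) 0 0).
have s2 : s ^+ 2 = (u *m u^T) 0 0 by rewrite sqr_sqrtr// rV_sq_ge0.
have cs : c ^+ 2 + s ^+ 2 = 1.
  have := congr1 (fun M : 'M[R]_1 => M 0 0) vv.
  rewrite vE tr_row_mx mul_row_col tr_scalar_mx -scalar_mxM mxE [(1%:M : 'M[R]_1) 0 0]mxE.
  by rewrite s2 expr2 [(_%:M : 'M[R]_1) 0 0]mxE eqxx.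
have [Q2 [Q2o Q2E]] : exists Q2 : 'M[R]_(1 + N), Q2 *m Q2^T = 1%:M /\
    s *: (row_mx 1%:M 0 *m Q2) = u.
  (* For s = 0 the vector u vanishes and has no direction to align; the identity serves. *)
  have [s0|s0] := eqVneq s 0.
    exists 1%:M; rewrite trmx1 mulmx1 s0 scale0r; split=> //.
    by apply/esym/rV_sq_eq0; rewrite -s2 s0 expr0n.
  have su : (s^-1 *: u) *m (s^-1 *: u)^T = 1%:M.
    rewrite linearZ/= -scalemxAl -scalemxAr scalerA [u *m _]mx11_scalar -s2.
    by rewrite scale_scalar_mx; congr (_%:M); field.
  have [Q2 [Q2o Q2E]] := householder su (ee N).
  by exists Q2; rewrite Q2E scalerA divff ?scale1r.
have [W WE] : {W | W = rot1 N c s *m diag1 Q2} by eexists.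
have Wo : W *m W^T = 1%:M.
  rewrite WE trmx_mul mulmxA -(mulmxA _ (diag1 Q2)) diag1_orth// mulmx1.
  exact: rot1_orth.
have eW : e *m W = v.
  rewrite WE.
  have -> : e = row_mx 1%:M (row_mx 0%:M 0) by rewrite raddf0 row_mx0.
  rewrite mulmxA row_mx_rot1.
  rewrite row_mx_diag1 !mulr1 !mulr0 subr0 addr0 vE; congr row_mx.
  rewrite -Q2E scalemxAl; congr (_ *m _).
  by rewrite scale_row_mx scaler0 scale_scalar_mx mulr1.
have WtW : W^T *m W = 1%:M by exact: mulmx1C.
have QWo : (Q *m W^T) *m (Q *m W^T)^T = 1%:M.
  by rewrite trmx_mul trmxK mulmxA -(mulmxA Q) WtW mulmx1.
have eQW : row_mx 1%:M 0 *m (Q *m W^T) = row_mx 1%:M 0.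
  by rewrite mulmxA -/e -/v -eW -mulmxA Wo mulmx1.
have [Q1 Q1o Q1E] := orth_diag1 QWo eQW.
by exists Q1, Q2, c, s; split=> //; rewrite -WE -Q1E -mulmxA WtW mulmx1.
Qed.

Lemma pid_mx_succ N p :
  block_mx 1%:M 0 0 (pid_mx p) = pid_mx p.+1 :> 'M[R]_(1 + N, 1 + p).
Proof.
apply/matrixP => i j; rewrite !mxE.
by case: (fintype.splitP i) => i' ->; rewrite !mxE; case: (fintype.splitP j) => j' ->;
  rewrite !mxE ?ord1.
Qed.

Lemma row_mx_pid N p (x : 'M[R]_1) (w : 'rV[R]_N) :
  (row_mx x w : 'rV[R]_(1 + N)) *m (pid_mx p.+1 : 'M[R]_(1 + N, 1 + p)) =
  row_mx x (w *m pid_mx p).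
Proof.
rewrite -pid_mx_succ mul_row_block.
by rewrite !mulmx0 mulmx1 addr0 add0r.
Qed.

(** Column by column: a reflection makes the first column a basis vector, orthonormality then clears
    the rest of the first row, and the remaining block again has orthonormal columns. *)
Lemma orth_complete N p (L : 'M[R]_(N, p)) : L^T *m L = 1%:M ->
  (p <= N)%N /\ exists2 Q : 'M[R]_N, Q *m Q^T = 1%:M & Q *m L = pid_mx p.
Proof.
elim: p N L => [|p IH] N L LL.
  by split=> //; exists 1%:M; rewrite ?trmx1 ?mulmx1// [LHS]thinmx0 [RHS]thinmx0.
change 'M[R]_(N, 1 + p) in L; change (L^T *m L = 1%:M) in LL.
case: N L LL => [|N] L LL.
  move/matrixP/(_ 0 0): LL; rewrite mxE big_ord0 mxE eqxx => /eqP.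
  by rewrite eq_sym oner_eq0.
pose l := lsubmx L.
have ll : l^T *m l = 1%:M.
  have := LL; rewrite -[L](@hsubmxK _ N.+1 1 p) tr_row_mx mul_col_row [RHS]scalar_mx_block.
  by move=> /eq_block_mx[].
have ee : (row_mx 1%:M 0 : 'rV[R]_(1 + N)) *m (row_mx 1%:M 0)^T = 1%:M.
  by rewrite tr_row_mx mul_row_col trmx1 mulmx1 trmx0 mulmx0 addr0.
have [Q0 [Q0o Q0E]] := @householder (1 + N) l^T (row_mx 1%:M 0)
  (etrans (congr1 (mulmx _) (trmxK l)) ll) ee.
pose M : 'M[R]_(1 + N, 1 + p) := Q0 *m L.
have MM : M^T *m M = 1%:M.
  by rewrite trmx_mul mulmxA -(mulmxA L^T) (mulmx1C Q0o) mulmx1.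
have Ml : lsubmx M = col_mx 1%:M 0.
  have -> : lsubmx M = Q0 *m l.
    by rewrite /M -{1}[L](@hsubmxK _ N.+1 1 p) mul_mx_row row_mxKl.
  rewrite -[l]trmxK -Q0E trmx_mul mulmxA Q0o mul1mx tr_row_mx trmx1.
  by rewrite trmx0.
have [r [L' ME]] : exists r L', M = block_mx 1%:M r 0 L'.
  exists (usubmx (rsubmx M)), (dsubmx (rsubmx M)).
  by rewrite block_mxEh vsubmxK -Ml hsubmxK.
move: MM; rewrite ME tr_block_mx mulmx_block !trmx0 !trmx1 !(mulmx0, mul0mx).
rewrite !mulmx1 mul1mx !addr0 [RHS]scalar_mx_block.
move=> /eq_block_mx[_ r0 _]; rewrite r0 mulmx0 add0r => L'o.
have [pN [Q' Q'o Q'E]] := IH _ _ L'o.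
split=> //; exists (diag1 Q' *m Q0).
  by rewrite trmx_mul mulmxA -(mulmxA _ Q0) Q0o mulmx1 diag1_orth.
rewrite -mulmxA; have -> : Q0 *m L = block_mx 1%:M 0 0 L' by rewrite -/M ME r0.
rewrite -[RHS]pid_mx_succ -Q'E.
exact: diag1_block.
Qed.

End Orthogonal.

(** * Invariance of the Gaussian law under orthogonal maps and projections *)

Section GaussianInvariance.
Variables (R : realType) (s : R).
Hypothesis s0 : s != 0.
Notation T := (measurableTypeR R).
Notation gam := (normal_prob 0 s).
Notation gE := (@gE R s).

Lemma gE_rot1 N (a b : R) (F : 'rV[R]_(1 + (1 + N)) -> \bar R) :
  a ^+ 2 + b ^+ 2 = 1 -> cmeas F -> (forall w, 0 <= F w)%E ->
  gE (fun w => F (w *m rot1 N a b)) = gE F.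
Proof.
move=> ab mF F0 /=.
pose k (z : T * T) := gE (fun w : 'rV_N => F (row_mx z.1%:M (row_mx z.2%:M w))).
have mk : measurable_fun setT k.
  apply: measurable_gE => // d Z g h mg mh.
  apply: (@jmeas_row_mx _ _ T N (fun x (w : 'rV_(1 + N)) => F (row_mx x%:M w)) _ _ Z g) => //.
  exact: cmeas_row_mx.
have k0 z : (0 <= k z)%E by exact: gE_ge0.
rewrite -(normal_prob_rotation s0 ab mk k0).
apply: eq_integral => x _; apply: eq_integral => y _.
by congr gE; apply/funext => w; rewrite row_mx_rot1.
Qed.

Lemma gE_diag1 N (Q : 'M[R]_N) (F : 'rV[R]_(1 + N) -> \bar R) :
  (forall G : 'rV[R]_N -> \bar R, cmeas G -> (forall w, 0 <= G w)%E ->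
     gE (fun w => G (w *m Q)) = gE G) ->
  cmeas F -> (forall w, 0 <= F w)%E ->
  gE (fun w => F (w *m diag1 Q)) = gE F.
Proof.
move=> HQ mF F0 /=; apply: eq_integral => x _.
rewrite -[RHS](HQ (fun w => F (row_mx x%:M w)))//; last exact: cmeas_section.
by congr gE; apply/funext => w; rewrite row_mx_diag1.
Qed.

Lemma gE_orth N (Q : 'M[R]_N) (F : 'rV[R]_N -> \bar R) : Q *m Q^T = 1%:M ->
  cmeas F -> (forall w, 0 <= F w)%E -> gE (fun w => F (w *m Q)) = gE F.
Proof.
elim: N Q F => [|[|N] IH] Q F QQ mF F0; first by rewrite /= [X in F X]thinmx0.
  have := congr1 (fun M : 'M[R]_1 => M 0 0) QQ.
  rewrite mxE big_ord1 !mxE eqxx/= -expr2 => /eqP; rewrite sqrf_eq1 => q1.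
  (* In dimension one the entry of Q is 1 or -1, and the symmetry of the density suffices. *)
  pose G x := F (row_mx x%:M 0 : 'rV_(1 + 0)).
  have mG : measurable_fun [set: T] G by exact: (@measurable_gE_section R s 0 F mF F0).
  rewrite [RHS]/= -/G; transitivity (\int[gam]_x G (x * Q 0 ord0)%R)%E.
    apply: eq_integral => x _; congr F; apply/rowP => i.
    have S (y : R) : (row_mx y%:M 0 : 'rV[R]_(1 + 0)) 0 ord0 = y.
      by rewrite mxE; case: fintype.splitP => [j _|[]//]; rewrite mxE ord1 eqxx.
    by rewrite (ord1 i) S mxE big_ord1 S.
  case/orP: q1 => /eqP ->; first by apply: eq_integral => x _; rewrite mulr1.
  etransitivity; last by apply: (normal_prob_sym s0 mG) => x; exact: F0.
  by apply: eq_integral => x _; rewrite mulrN1.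
have [Q1 [Q2 [a [b [Q1o Q2o ab ->]]]]] := orth_decomp QQ.
pose F2 w := F (w *m diag1 Q2); pose F3 w := F2 (w *m rot1 N a b).
transitivity (gE (fun w => F3 (w *m diag1 Q1))).
  by congr gE; apply/funext => w; rewrite /F3 /F2 !mulmxA.
have mF2 : cmeas F2 by exact: cmeas_lin.
have mF3 : cmeas F3 by exact: cmeas_lin.
have HQ1 := @gE_diag1 _ Q1 F3 (fun G mG G0 => IH Q1 G Q1o mG G0) mF3 (fun w => F0 _).
have HQ2 := @gE_diag1 _ Q2 F (fun G mG G0 => IH Q2 G Q2o mG G0) mF F0.
have HR := @gE_rot1 N a b F2 ab mF2 (fun w => F0 _).
transitivity (gE F3); first exact: HQ1.
by transitivity (gE F2); [exact: HR|exact: HQ2].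
Qed.

(** The coordinates beyond the first [p] are integrated out against probability measures. *)
Lemma gE_pid N p (F : 'rV[R]_p -> \bar R) : (p <= N)%N ->
  gE (fun w : 'rV_N => F (w *m pid_mx p)) = gE F.
Proof.
elim: N p F => [|N IH] [|p] F //= pN.
- by rewrite [X in F X]thinmx0.
- rewrite -[RHS](gE_cst s N.+1) /=.
  by apply: eq_integral => x _; congr gE; apply/funext => w; congr F; exact: thinmx0.
apply: eq_integral => x _; rewrite -(IH p)//.
by congr gE; apply/funext => w; congr F; exact: row_mx_pid.
Qed.

(** Up to an orthogonal change of variables, which preserves the law, [L] is the projection onto the
    first [p] coordinates. *)
Lemma gE_law N p (L : 'M[R]_(N, p)) (F : 'rV[R]_p -> \bar R) : L^T *m L = 1%:M ->
  cmeas F -> (forall w, 0 <= F w)%E -> gE (fun w => F (w *m L)) = gE F.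
Proof.
move=> LL mF F0; have [pN [Q QQ QL]] := orth_complete LL.
rewrite -(gE_orth QQ (F := fun w => F (w *m L)))//; last exact: cmeas_lin.
rewrite -[RHS](gE_pid F pN); congr gE; apply/funext => w.
by rewrite -mulmxA QL.
Qed.

Lemma gE_second_moment N :
  (gE (fun w : 'rV[R]_N => (\sum_i w 0 i ^+ 2)%:E) <= (N%:R * s ^+ 2)%:E)%E.
Proof.
have msq M : cmeas (fun w : 'rV[R]_M => (\sum_i w 0 i ^+ 2)%:E).
  have := @cmeas_sum R M _ (index_enum 'I_M) (fun i w => (w 0 i)%:E * (w 0 i)%:E)%E
    (fun i => cmeas_mul (@cmeas_coord R M i) (@cmeas_coord R M i)).
  by congr cmeas; apply/funext => w; rewrite -sumEFin.
have sq0 M (w : 'rV[R]_M) : (0 <= (\sum_i w 0 i ^+ 2)%:E)%E.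
  by rewrite lee_fin sumr_ge0// => i _; exact: sqr_ge0.
elim: N => [|N IH]; first by rewrite /= big_ord0 mul0r.
have E x : gE (fun w : 'rV_N =>
      (\sum_i (row_mx x%:M w : 'rV[R]_(1 + N)) 0 i ^+ 2)%:E) =
    ((x ^+ 2)%:E + gE (fun w : 'rV[R]_N => (\sum_i w 0 i ^+ 2)%:E))%E.
  rewrite -[X in (X + _)%E](gE_cst s N) -gE_add//; last first.
    by move=> w; rewrite lee_fin sqr_ge0.
  congr gE; apply/funext => w; rewrite big_split_ord big_ord1 row_mxEl mxE eqxx.
  by rewrite EFinD; congr (_ + _%:E)%E; apply: eq_bigr => i _; rewrite row_mxEr.
have mx2 : measurable_fun [set: T] (fun x : T => (x ^+ 2)%:E).
  by apply/measurable_EFinP; exact: measurable_funX.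
have -> : (N.+1%:R * s ^+ 2)%:E = ((s ^+ 2)%:E + (N%:R * s ^+ 2)%:E)%E.
  by rewrite -EFinD -natr1 mulrDl mul1r addrC.
rewrite /=; under eq_integral do rewrite E.
set c := gE _.
have -> : (\int[gam]_x ((x ^+ 2)%:E + c) = \int[gam]_x (x ^+ 2)%:E + \int[gam]_x c)%E.
  apply: ge0_integralD => //; first by move=> x _; rewrite lee_fin sqr_ge0.
  by move=> x _; exact: gE_ge0.
apply: leeD; first exact: normal_second_moment.
apply: le_trans IH; rewrite le_eqVlt; apply/orP; left; apply/eqP.
etransitivity; first exact: (@integral_cst _ _ _ gam setT measurableT).
by rewrite -[RHS]mule1; congr (_ * _)%E; exact: probability_setT.
Qed.

End GaussianInvariance.

(** * Polar decomposition over a field with involution *)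

(* The common structure of R and R[i]: a field with an involution, whose real
   part makes it a Euclidean space over R with orthonormal basis [bs]. *)
Record starField (R : realType) := StarField {
  sfield :> fieldType;
  cj : {rmorphism sfield -> sfield};
  re : {additive sfield -> R};
  io : {rmorphism R -> sfield};
  sdim : nat;
  bs : 'I_sdim -> sfield;
  cjK : involutive cj;
  re_cj : forall x, re (cj x) = re x;
  re_io : forall r x, re (io r * x) = r * re x;
  cj_io : forall r, cj (io r) = io r;
  bs_expand : forall x, x = \sum_k io (re (x * cj (bs k))) * bs k;
  bs_orth : forall k l, re (bs k * cj (bs l)) = (k == l)%:R;
  cj_self : forall x, cj x = x -> x = io (re x) }.

Section Adjoint.
Variables (R : realType) (T : starField R).
Local Notation cj := (cj T).
Local Notation re := (re T).
Local Notation io := (io T).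

Lemma re1 : re 1 = 1.
Proof. by apply: (fmorph_inj io); rewrite rmorph1 -cj_self ?rmorph1. Qed.

Lemma re_io_id (r : R) : re (io r) = r.
Proof. by rewrite -[io r]mulr1 re_io re1 mulr1. Qed.

(** Parseval's identity in the basis [bs]; it gives definiteness of the form. *)
Lemma re_mul_cj x y : re (x * cj y) = \sum_k re (x * cj (bs k)) * re (y * cj (bs k)).
Proof.
rewrite {1}(bs_expand x) mulr_suml raddf_sum; apply: eq_bigr => k _.
rewrite -mulrA re_io; congr (_ * _).
by rewrite -re_cj rmorphM cjK mulrC.
Qed.

Lemma re_sq_ge0 x : 0 <= re (x * cj x).
Proof. by rewrite re_mul_cj sumr_ge0// => k _; rewrite -expr2 sqr_ge0. Qed.

Lemma re_sq_eq0 x : re (x * cj x) = 0 -> x = 0.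
Proof.
rewrite re_mul_cj => /eqP; rewrite psumr_eq0; last first.
  by move=> k _; rewrite -expr2 sqr_ge0.
move=> /allP x0; rewrite (bs_expand x) big1// => k _.
have := x0 k (mem_index_enum _); rewrite mulf_eq0 orbb => /eqP ->.
by rewrite rmorph0 mul0r.
Qed.

Definition adj m k (A : 'M[T]_(m, k)) : 'M[T]_(k, m) := (map_mx cj A)^T.

Lemma adjE m k (A : 'M[T]_(m, k)) i j : adj A i j = cj (A j i).
Proof. by rewrite !mxE. Qed.

Lemma adjK m k (A : 'M[T]_(m, k)) : adj (adj A) = A.
Proof. by apply/matrixP => i j; rewrite !adjE cjK. Qed.

Lemma adjM m k l (A : 'M[T]_(m, k)) (B : 'M[T]_(k, l)) :
  adj (A *m B) = adj B *m adj A.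
Proof. by rewrite /adj map_mxM trmx_mul. Qed.

Lemma adjD m k (A B : 'M[T]_(m, k)) : adj (A + B) = adj A + adj B.
Proof. by rewrite /adj map_mxD linearD. Qed.

Lemma adjN m k (A : 'M[T]_(m, k)) : adj (- A) = - adj A.
Proof. by rewrite /adj map_mxN linearN. Qed.

Lemma adjB m k (A B : 'M[T]_(m, k)) : adj (A - B) = adj A - adj B.
Proof. by rewrite adjD adjN. Qed.

Lemma adjZ m k (r : R) (A : 'M[T]_(m, k)) : adj (io r *: A) = io r *: adj A.
Proof. by apply/matrixP => i j; rewrite !(adjE, mxE) rmorphM cj_io. Qed.

Lemma adj0 m k : adj (0 : 'M[T]_(m, k)) = 0.
Proof. by apply/matrixP => i j; rewrite !(adjE, mxE) rmorph0. Qed.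

Lemma adj1 m : adj (1%:M : 'M[T]_m) = 1%:M.
Proof. by rewrite /adj map_mx1 trmx1. Qed.

Lemma adj_col_mx m1 m2 k (A : 'M[T]_(m1, k)) (B : 'M[T]_(m2, k)) :
  adj (col_mx A B) = row_mx (adj A) (adj B).
Proof. by rewrite /adj map_col_mx tr_col_mx. Qed.

Lemma adj_row_mx m k1 k2 (A : 'M[T]_(m, k1)) (B : 'M[T]_(m, k2)) :
  adj (row_mx A B) = col_mx (adj A) (adj B).
Proof. by rewrite /adj map_row_mx tr_row_mx. Qed.

Lemma trace_adj m (A : 'M[T]_m) : \tr (adj A) = cj (\tr A).
Proof. by rewrite /mxtrace rmorph_sum; apply: eq_bigr => i _; rewrite adjE. Qed.

Definition ip m k (A B : 'M[T]_(m, k)) : R := re (\tr (A *m adj B)).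

Lemma ipE m k (A B : 'M[T]_(m, k)) : ip A B = \sum_i \sum_j re (A i j * cj (B i j)).
Proof.
rewrite /ip /mxtrace raddf_sum; apply: eq_bigr => i _.
by rewrite mxE raddf_sum; apply: eq_bigr => j _; rewrite adjE.
Qed.

Lemma ipC m k (A B : 'M[T]_(m, k)) : ip A B = ip B A.
Proof. by rewrite /ip -re_cj -trace_adj adjM adjK. Qed.

Lemma ipDl m k (A B C : 'M[T]_(m, k)) : ip (A + B) C = ip A C + ip B C.
Proof. by rewrite /ip mulmxDl linearD raddfD. Qed.

Lemma ipNl m k (A B : 'M[T]_(m, k)) : ip (- A) B = - ip A B.
Proof. by rewrite /ip mulNmx linearN raddfN. Qed.

Lemma ipBl m k (A B C : 'M[T]_(m, k)) : ip (A - B) C = ip A C - ip B C.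
Proof. by rewrite ipDl ipNl. Qed.

Lemma ipZl m k r (A B : 'M[T]_(m, k)) : ip (io r *: A) B = r * ip A B.
Proof. by rewrite /ip -scalemxAl linearZ/= re_io. Qed.

Lemma ipDr m k (A B C : 'M[T]_(m, k)) : ip A (B + C) = ip A B + ip A C.
Proof. by rewrite ipC ipDl !(ipC A). Qed.

Lemma ipNr m k (A B : 'M[T]_(m, k)) : ip A (- B) = - ip A B.
Proof. by rewrite ipC ipNl ipC. Qed.

Lemma ipBr m k (A B C : 'M[T]_(m, k)) : ip A (B - C) = ip A B - ip A C.
Proof. by rewrite ipDr ipNr. Qed.

Lemma ipZr m k r (A B : 'M[T]_(m, k)) : ip A (io r *: B) = r * ip A B.
Proof. by rewrite ipC ipZl ipC. Qed.

Lemma ip0l m k (A : 'M[T]_(m, k)) : ip 0 A = 0.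
Proof. by rewrite /ip mul0mx linear0 raddf0. Qed.

Lemma ip_mull m k l (M : 'M[T]_(m, k)) (A : 'M[T]_(k, l)) B :
  ip (M *m A) B = ip A (adj M *m B).
Proof. by rewrite /ip adjM adjK -mulmxA mxtrace_mulC mulmxA. Qed.

Lemma ip_mulr m k l (A : 'M[T]_(m, k)) (M : 'M[T]_(k, l)) B :
  ip (A *m M) B = ip A (B *m adj M).
Proof. by rewrite /ip adjM adjK -mulmxA. Qed.

Lemma ip_ge0 m k (A : 'M[T]_(m, k)) : 0 <= ip A A.
Proof.
rewrite ipE; apply: sumr_ge0 => i _; apply: sumr_ge0 => j _; exact: re_sq_ge0.
Qed.

Lemma ip_eq0 m k (A : 'M[T]_(m, k)) : ip A A = 0 -> A = 0.
Proof.
rewrite ipE => /eqP; rewrite psumr_eq0; last first.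
  by move=> i _; apply: sumr_ge0 => j _; exact: re_sq_ge0.
move=> /allP A0; apply/matrixP => i j; rewrite mxE.
have := A0 i (mem_index_enum _); rewrite psumr_eq0; last by move=> ? _; exact: re_sq_ge0.
by move=> /allP/(_ j (mem_index_enum _))/eqP/re_sq_eq0.
Qed.

Lemma ip_sqB m k (A B : 'M[T]_(m, k)) :
  ip (A - B) (A - B) = ip A A - 2 * ip A B + ip B B.
Proof. by rewrite ipBl !ipBr (ipC B A); ring. Qed.

Lemma ip_le_half m k (A B : 'M[T]_(m, k)) : 2 * ip A B <= ip A A + ip B B.
Proof. by have := ip_ge0 (A - B); rewrite ip_sqB; lra. Qed.

Definition unitary d (Z : 'M[T]_d) : Prop := Z *m adj Z = 1%:M.

Lemma unitary_adj d (Z : 'M[T]_d) : unitary Z -> adj Z *m Z = 1%:M.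
Proof. exact: mulmx1C. Qed.

Lemma unitaryM d (Y Z : 'M[T]_d) : unitary Y -> unitary Z -> unitary (Y *m Z).
Proof. by move=> hY hZ; rewrite /unitary adjM mulmxA -(mulmxA Y) hZ mulmx1. Qed.

Lemma unitary_adjP d (Z : 'M[T]_d) : unitary Z -> unitary (adj Z).
Proof. by move=> hZ; rewrite /unitary adjK unitary_adj. Qed.

Lemma unitary1 d : unitary (1%:M : 'M[T]_d).
Proof. by rewrite /unitary adj1 mulmx1. Qed.

Lemma ip1 d (A : 'M[T]_d) : ip A 1%:M = re (\tr A).
Proof. by rewrite /ip adj1 mulmx1. Qed.

Lemma re_natr k : re k%:R = k%:R.
Proof. by rewrite raddfMn re1. Qed.

Lemma ip_unitary d k (Z : 'M[T]_(d, k)) : Z *m adj Z = 1%:M -> ip Z Z = d%:R.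
Proof. by move=> hZ; rewrite /ip hZ mxtrace1 re_natr. Qed.

Lemma mul_adj_row k (u : 'rV[T]_k) : u *m adj u = (io (ip u u))%:M.
Proof.
rewrite [LHS]mx11_scalar; congr (_%:M).
have -> : ip u u = re ((u *m adj u) 0 0) by rewrite /ip /mxtrace big_ord1.
by apply: cj_self; rewrite -adjE adjM adjK.
Qed.

Lemma ip_unitaryl d k (Z : 'M[T]_d) (A B : 'M[T]_(d, k)) : unitary Z ->
  ip (Z *m A) (Z *m B) = ip A B.
Proof. by move=> hZ; rewrite ip_mull mulmxA unitary_adj// mul1mx. Qed.

Lemma ip_row m k (A B : 'M[T]_(m, k)) : ip A B = \sum_i ip (row i A) (row i B).
Proof.
rewrite ipE; apply: eq_bigr => i _; rewrite ipE big_ord1.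
by apply: eq_bigr => j _; rewrite !mxE.
Qed.

End Adjoint.

Section Polar.
Variables (R : realType) (T : starField R).
Local Notation cj := (cj T).
Local Notation re := (re T).
Local Notation io := (io T).

(** A variational definition, so that no singular value decomposition has to be constructed. It
    agrees with the nearest unitary matrix by [polar_argmin], and allows several factors when M is
    singular. *)
Definition is_polar d (M P : 'M[T]_d) : Prop :=
  unitary P /\ forall Z, unitary Z -> ip Z M <= ip P M.

Variables (d : nat) (M P : 'M[T]_d).
Hypothesis MP : is_polar M P.
Let H := M *m adj P.

Lemma polar_maxH (Y : 'M[T]_d) : unitary Y -> ip Y H <= ip 1%:M H.
Proof.
move=> hY; have [hP maxP] := MP.
have := maxP _ (unitaryM hY hP); rewrite ip_mulr -/H => /le_trans; apply.
by rewrite -[in leLHS](mul1mx P) ip_mulr.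
Qed.

(* First-order optimality along the Cayley transforms (1 - tK)^-1 (1 + tK). *)
Lemma polar_skew (K : 'M[T]_d) : adj K = - K -> ip K H <= 0.
Proof.
move=> Ksk; rewrite leNgt; apply/negP => p0.
(* [c] bounds the second-order remainder: Y - 1 = 2 t K + t^2 K^2 (Y + 1), and - (<Y, C> + <1, C>)
   <= c by [ip_le_half], since |Y|^2 = |1|^2 = d. Optimality then gives 2 p <= t c, contradicted by
   the choice of t, for which t c = p - t < p. *)
pose C := adj (K *m K) *m H; pose c := d%:R + ip C C.
have c0 : 0 <= c by rewrite addr_ge0// ip_ge0.
pose p := ip K H; pose t := p / (c + 1).
have c1 : 0 < c + 1 by lra.
have t0 : 0 < t by rewrite divr_gt0.
pose tK := io t *: K; have tKsk : adj tK = - tK by rewrite adjZ Ksk scalerN.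
pose A := 1%:M - tK.
have adjA : adj A = 1%:M + tK by rewrite adjB adj1 tKsk opprK.
(* If v A = 0 then v = v tK, and |v|^2 = <v tK, v> vanishes because tK is skew. *)
have Au : A \in unitmx.
  rewrite -row_free_unit -kermx_eq0; apply/rowV0P => v /sub_kermxP.
  rewrite mulmxBr mulmx1 => /eqP; rewrite subr_eq0 => /eqP vE.
  have e1 : ip (v *m tK) v = - ip (v *m tK) v.
    by rewrite {1}ip_mulr tKsk mulmxN ipNr ipC.
  by apply: ip_eq0; rewrite {1}vE; lra.
pose Y := invmx A *m adj A.
have comA : A *m adj A = adj A *m A.
  rewrite adjA /A mulmxBl mul1mx mulmxDr mulmx1 mulmxDl mul1mx mulmxBr mulmx1.
  by rewrite opprD !addrA addrK subrK.
have hY : unitary Y.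
  rewrite /unitary /Y adjM adjK -mulmxA (mulmxA (adj A)) -comA !mulmxA.
  by rewrite mulVmx// mul1mx -adjM mulVmx// adj1.
have YE : Y - 1%:M = tK *m (Y + 1%:M).
  have : A *m Y = adj A by rewrite /Y mulmxA mulmxV// mul1mx.
  rewrite adjA /A mulmxBl mul1mx mulmxDr mulmx1 => /eqP.
  by rewrite subr_eq => /eqP {1}->; rewrite [LHS]addrAC [1%:M + tK]addrC addrK addrC.
have YE2 : Y - 1%:M = io (2 * t) *: K + io (t ^+ 2) *: (K *m K *m (Y + 1%:M)).
  have E : Y + 1%:M = tK *m (Y + 1%:M) + 1%:M *+ 2 by rewrite -YE mulr2n addrA subrK.
  rewrite YE {1}E mulmxDr addrC; congr (_ + _).
    by rewrite -scaler_nat -scalemxAr mulmx1 scaler_nat scalerMnl mulr_natl rmorphMn.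
  rewrite /tK -!scalemxAl -scalemxAr scalerA -rmorphM expr2 mulmxA.
  by [].
have := polar_maxH hY; rewrite -subr_le0 -ipBl YE2 ipDl !ipZl -/p.
rewrite ip_mull -/C ipDl => le0.
have h1 := ip_le_half (- Y) C; have h2 := ip_le_half (- 1%:M) C.
move: h1 h2; rewrite !ipNl !ipNr !opprK (ip_unitary hY) (ip_unitary (unitary1 T d)) => h1 h2.
have h3 : - c <= ip Y C + ip 1%:M C by rewrite /c; lra.
have h4 : 2 * p <= t * c.
  rewrite -(ler_pM2l t0); move: le0 h3; move: (ip Y C + _) => q le0 h3.
  have : 0 <= t ^+ 2 * (q + c) by rewrite mulr_ge0 ?sqr_ge0//; lra.
  lra.
have h5 : t * (c + 1) = p by rewrite /t divfK// gt_eqF.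
have pt : p <= - t by lra.
by have := lt_le_trans p0 pt; rewrite oppr_gt0 => /(lt_trans t0); rewrite ltxx.
Qed.

(** In the skew direction K = H - adj H one has <K, H> = |K|^2 / 2, so K = 0. *)
Lemma polar_herm : adj H = H.
Proof.
have K0 : adj (H - adj H) = - (H - adj H) by rewrite adjB adjK opprB.
have := polar_skew K0.
have -> : ip (H - adj H) H = 2^-1 * ip (H - adj H) (H - adj H).
  rewrite ipBr ipBl [ip (H - adj H) (adj H)]ipBl.
  have -> : ip (adj H) (adj H) = ip H H.
    by rewrite /ip adjK mxtrace_mulC.
  by rewrite (ipC (adj H) H); field.
rewrite pmulr_rle0 ?invr_gt0// => le0.
have /eqP : ip (H - adj H) (H - adj H) = 0 by apply/eqP; rewrite eq_le le0 ip_ge0.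
by move=> /eqP/ip_eq0/eqP; rewrite subr_eq0 => /eqP.
Qed.

(** For each row u of A, the identity is compared with the reflection along u: their difference is a
    positive multiple of [adj u *m u], whose inner product with H is the value of the form at u. *)
Lemma polar_psd k (A : 'M[T]_(k, d)) : 0 <= ip (A *m H) A.
Proof.
rewrite ip_row sumr_ge0// => i _; rewrite row_mul; move: (row i A) => u {A i}.
have [->|u0] := eqVneq u 0; first by rewrite mul0mx ip0l.
have n0 : 0 < ip u u.
  by rewrite lt_neqAle ip_ge0 andbT; apply: contra u0 => /eqP/esym/ip_eq0 ->.
pose W := adj u *m u; pose a := 2 / ip u u.
have WW : W *m W = io (ip u u) *: W.
  by rewrite /W mulmxA -(mulmxA (adj u)) mul_adj_row mul_mx_scalar -scalemxAl.
have adjW : adj W = W by rewrite /W adjM adjK.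
have hY : unitary (1%:M - io a *: W).
  rewrite /unitary adjB adj1 adjZ adjW mulmxBl mul1mx mulmxBr mulmx1.
  rewrite -scalemxAl -scalemxAr WW !scalerA -!rmorphM.
  rewrite (_ : a * a * ip u u = a + a); last by rewrite /a; field; rewrite gt_eqF.
  by rewrite rmorphD scalerDl opprB addrK subrK.
have := polar_maxH hY; rewrite ipBl ipZl gerBl pmulr_rge0 ?divr_gt0//.
by rewrite /W ip_mull adjK ipC.
Qed.

Lemma polar_decomp : M = H *m P.
Proof. by rewrite -mulmxA unitary_adj ?mulmx1//; case: MP. Qed.

Lemma polar_trace : ip P M = ip 1%:M H.
Proof. by rewrite -[in LHS](mul1mx P) ip_mulr. Qed.

End Polar.

(** * Averaging over signed cyclic shifts *)

Section Averaging.
Variables (R : realType) (T : starField R).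
Local Notation cj := (cj T).
Local Notation re := (re T).
Local Notation io := (io T).

Lemma ip_suml m k I (r : seq I) (F : I -> 'M[T]_(m, k)) B :
  ip (\sum_(i <- r) F i) B = \sum_(i <- r) ip (F i) B.
Proof.
by elim: r => [|i r IH]; rewrite ?big_nil ?ip0l// !big_cons ipDl IH.
Qed.

(* With M = H P the polar decomposition, this is 0 <= |(S - Q P^* ) H^(1/2)|^2. *)
Lemma polar_key d (M P S Q : 'M[T]_d) : is_polar M P -> unitary Q ->
  2 * ip Q (S *m M) <= ip (S *m (M *m adj P)) S + ip P M.
Proof.
move=> MP hQ; have hP : unitary P by case: MP.
rewrite (polar_trace M P) {1}(polar_decomp MP).
have Hh := polar_herm MP; have Hp := polar_psd MP.
move: (M *m adj P) Hh Hp => H Hh Hp.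
pose Y := Q *m adj P.
have hY : unitary Y by exact: unitaryM (unitary_adjP hP).
have -> : ip Q (S *m (H *m P)) = ip Y (S *m H).
  by rewrite /Y ip_mulr adjK mulmxA.
have := Hp _ (S - Y); rewrite mulmxBl ipBl !ipBr.
have -> : ip (S *m H) Y = ip Y (S *m H) by rewrite ipC.
have -> : ip (Y *m H) S = ip Y (S *m H) by rewrite ip_mulr Hh.
have -> : ip (Y *m H) Y = ip 1%:M H.
  by rewrite ip_mull unitary_adj// ipC.
by move=> h; lra.
Qed.

Variable D : nat.

(** Addition in ['I_D.+1] is cyclic. Under conjugation the signs cancel off-diagonal entries and the
    shifts equalise the diagonal: a finite substitute for averaging over the whole unitary group. *)
Definition sgshift (eps : {ffun 'I_D.+1 -> bool}) (j : 'I_D.+1) : 'M[T]_D.+1 :=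
  \matrix_(a, b) ((-1) ^+ eps a *+ (b == a + j)).

Lemma sgshift_conj eps j (K : 'M[T]_D.+1) a b :
  (sgshift eps j *m K *m adj (sgshift eps j)) a b =
  (-1) ^+ eps a * (-1) ^+ eps b * K (a + j) (b + j).
Proof.
rewrite mxE (bigD1 (b + j))//= big1 ?addr0; last first.
  move=> c cb; rewrite adjE [sgshift _ _ _ _]mxE (negbTE cb) mulr0n rmorph0.
  by rewrite mulr0.
rewrite adjE [sgshift _ _ b _]mxE eqxx mulr1n rmorphXn rmorphN rmorph1.
rewrite mxE (bigD1 (a + j))//= big1 ?addr0; last first.
  by move=> c ca; rewrite mxE (negbTE ca) mulr0n mul0r.
by rewrite mxE eqxx mulr1n mulrAC.
Qed.

Lemma sgshift_unitary eps j : unitary (sgshift eps j).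
Proof.
apply/matrixP => a b; rewrite -[sgshift eps j as X in X *m _]mulmx1 sgshift_conj !mxE.
rewrite (inj_eq (addIr j)); case: eqP => [->|_]; last by rewrite mulr0.
by rewrite mulr1 -expr2 sqrr_sign.
Qed.

Lemma sgshift_sum (K : 'M[T]_D.+1) :
  \sum_eps \sum_j (sgshift eps j *m K *m adj (sgshift eps j)) =
  ((2 ^ D.+1)%:R * \tr K)%:M.
Proof.
apply/matrixP => a b; rewrite summxE.
under eq_bigr do rewrite summxE.
under eq_bigr do under eq_bigr do rewrite sgshift_conj.
rewrite mxE.
transitivity ((\sum_(eps : {ffun 'I_D.+1 -> bool}) (-1) ^+ eps a * (-1) ^+ eps b) *
    (\sum_j K (a + j) (b + j))).
  by rewrite mulr_suml; apply: eq_bigr => eps _; rewrite mulr_sumr.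
have [->|ab] := eqVneq a b.
  congr (_ * _).
    under eq_bigr do rewrite -expr2 sqrr_sign.
    by rewrite sumr_const card_ffun card_bool card_ord.
  by rewrite [RHS](reindex_inj (addrI b)).
rewrite mulr0n; set s := \sum_(_ | _) _.
suff -> : s = 0 by rewrite mul0r.
(* Flipping the sign at a alone negates every term, because a and b differ; hence s = - s. *)
pose flip (eps : {ffun 'I_D.+1 -> bool}) := [ffun c => (c == a) (+) eps c].
have flipK : involutive flip.
  by move=> eps; apply/ffunP => c; rewrite !ffunE addKb.
have sN : s = - s.
  rewrite {1}/s (reindex_inj (inv_inj flipK)) -sumrN; apply: eq_bigr => eps _.
  by rewrite !ffunE eqxx eq_sym (negbTE ab) /= signrN mulNr.
have : s *+ 2 = 0 by rewrite mulr2n {1}sN addNr.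
move/eqP; rewrite -mulr_natl mulf_eq0 => /orP[|/eqP//].
(* The embedding of R excludes characteristic 2. *)
rewrite -(rmorph_nat io) fmorph_eq0 pnatr_eq0.
by [].
Qed.

Lemma sgshift_card (c : R) :
  \sum_(eps : {ffun 'I_D.+1 -> bool}) \sum_(j < D.+1) c = (2 ^ D.+1)%:R * D.+1%:R * c.
Proof.
rewrite big_const_ord iter_addr_0 sumr_const card_ffun card_bool card_ord.
by rewrite -mulrnA -natrM mulr_natl mulnC.
Qed.

Lemma polar_key_avg (M P S : 'M[T]_D.+1) (Q : _ -> _ -> 'M[T]_D.+1) :
  is_polar M P -> (forall eps j, unitary (Q eps j)) ->
  \sum_eps \sum_j 2 * ip (Q eps j) (S *m sgshift eps j *m M) <=
  (2 ^ D.+1)%:R * (ip S S + D.+1%:R) * ip P M.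
Proof.
move=> MP hQ.
pose H := M *m adj P; have Hh : adj H = H by exact: polar_herm.
apply: (@le_trans _ _ (\sum_eps \sum_j
   (ip (S *m (sgshift eps j *m H *m adj (sgshift eps j))) S + ip P M))).
  apply: ler_sum => eps _; apply: ler_sum => j _.
  have := polar_key (S *m sgshift eps j) MP (hQ eps j).
  by rewrite -/H => /le_trans; apply; rewrite !mulmxA [in leRHS]ip_mulr adjK.
under eq_bigr do rewrite big_split/=.
rewrite big_split /= sgshift_card mulrDr mulrDl lerD2r.
have -> : \sum_eps \sum_j ip (S *m (sgshift eps j *m H *m adj (sgshift eps j))) S =
  ip (S *m (\sum_eps \sum_j (sgshift eps j *m H *m adj (sgshift eps j)))) S.
  rewrite mulmx_sumr ip_suml; apply: eq_bigr => eps _.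
  by rewrite mulmx_sumr ip_suml.
rewrite sgshift_sum mul_mx_scalar.
have -> : \tr H = io (ip P M).
  rewrite (polar_trace M P) ipC ip1; apply: cj_self.
  by rewrite -trace_adj Hh.
by rewrite -(rmorph_nat io) -rmorphM ipZl mulrAC.
Qed.

(** The same averaging applied to [G *m adj G]. Through it, the expectation of a quadratic form
    follows from that of |G|^2 alone, without covariances. *)
Lemma trace_avg n (K : 'M[T]_D.+1) (G : 'M[T]_(D.+1, n)) :
  \sum_eps \sum_j ip (K *m (sgshift eps j *m G)) (sgshift eps j *m G) =
  (2 ^ D.+1)%:R * ip G G * re (\tr K).
Proof.
transitivity (re (\tr (K *m (\sum_eps \sum_j
     (sgshift eps j *m (G *m adj G) *m adj (sgshift eps j)))))).
  rewrite -ip1 mulmx_sumr ip_suml; apply: eq_bigr => eps _.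
  rewrite mulmx_sumr ip_suml; apply: eq_bigr => j _.
  by rewrite ip1 /ip adjM !mulmxA.
rewrite sgshift_sum mul_mx_scalar linearZ/=.
have -> : \tr (G *m adj G) = io (ip G G).
  by rewrite /ip; apply: cj_self; rewrite -trace_adj adjM adjK.
by rewrite -(rmorph_nat io) -rmorphM re_io.
Qed.

End Averaging.

(** * Real coordinates and the nuclear norm *)

Section Coordinates.
Variables (R : realType) (T : starField R).
Local Notation cj := (cj T).
Local Notation re := (re T).
Local Notation io := (io T).

(** The numbering of the real coordinates is a parameter because the two Gaussian expectations of
    the statement list the entries in different orders. *)
Record coords (m k K : nat) := Coords {
  cidx : 'I_(sdim T) * ('I_m * 'I_k) -> 'I_K;
  cinv : 'I_K -> 'I_(sdim T) * ('I_m * 'I_k);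
  cidxK : cancel cidx cinv;
  cinvK : cancel cinv cidx }.

Variables (m k K : nat) (X : coords m k K).

Definition mat (w : 'rV[R]_K) : 'M[T]_(m, k) :=
  \matrix_(i, j) \sum_c io (w 0 (cidx X (c, (i, j)))) * bs c.

Definition vec (A : 'M[T]_(m, k)) : 'rV[R]_K :=
  \row_l re (A (cinv X l).2.1 (cinv X l).2.2 * cj (bs (cinv X l).1)).

Lemma vecK A : mat (vec A) = A.
Proof.
apply/matrixP => i j; rewrite mxE [RHS]bs_expand; apply: eq_bigr => c _.
by rewrite mxE cidxK.
Qed.

Lemma matK w : vec (mat w) = w.
Proof.
apply/rowP => l; rewrite !mxE mulr_suml raddf_sum.
case E : (cinv X l) => [c [i j]] /=.
rewrite (bigD1 c)//= big1 ?addr0; last first.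
  by move=> c' c'c; rewrite -mulrA re_io bs_orth (negbTE c'c) mulr0.
by rewrite -mulrA re_io bs_orth eqxx mulr1 -E cinvK.
Qed.

Lemma vec_dot A B : vec A *m (vec B)^T = (ip A B)%:M.
Proof.
rewrite [LHS]mx11_scalar mxE; congr (_%:M).
rewrite (reindex (cidx X)) /=; last first.
  by exists (cinv X) => ? _; [exact: cidxK|exact: cinvK].
transitivity (\sum_(p : 'I_(sdim T) * ('I_m * 'I_k))
    re (A p.2.1 p.2.2 * cj (bs p.1)) * re (B p.2.1 p.2.2 * cj (bs p.1))).
  by apply: eq_bigr => p _; rewrite !mxE cidxK.
rewrite -(pair_bigA _ (fun c q => re (A q.1 q.2 * cj (bs c)) * re (B q.1 q.2 * cj (bs c)))) /=.
rewrite exchange_big /= -(pair_bigA _ (fun i j => \sum_c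
  re (A i j * cj (bs c)) * re (B i j * cj (bs c)))) /= ipE.
by apply: eq_bigr => i _; apply: eq_bigr => j _; rewrite -re_mul_cj.
Qed.

Lemma mat_dot u v : u *m v^T = (ip (mat u) (mat v))%:M.
Proof. by rewrite -vec_dot !matK. Qed.

Lemma mat_sq u : ip (mat u) (mat u) = \sum_i u 0 i ^+ 2.
Proof.
transitivity ((u *m u^T) 0 0); first by rewrite mat_dot mxE eqxx.
by rewrite mxE; apply: eq_bigr => i _; rewrite mxE expr2.
Qed.

Lemma vec_linear a A B : vec (io a *: A + B) = a *: vec A + vec B.
Proof.
apply/rowP => l; rewrite !mxE mulrDl raddfD/=; congr (_ + _).
by rewrite -mulrA re_io.
Qed.

Lemma mat_linear a u v : mat (a *: u + v) = io a *: mat u + mat v.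
Proof. by rewrite -[in LHS](matK u) -[in LHS](matK v) -vec_linear vecK. Qed.

Lemma matB u v : mat (u - v) = mat u - mat v.
Proof. by rewrite addrC -scaleN1r mat_linear rmorphN1 scaleN1r addrC. Qed.

End Coordinates.

Section LeftMultiplication.
Variables (R : realType) (T : starField R).
Variables (m n k K K' : nat) (X : coords T n k K) (X' : coords T m k K').
Variable A : 'M[T]_(m, n).

Definition lmulv (w : 'rV[R]_K) : 'rV[R]_K' := vec X' (A *m mat X w).

Lemma lmulv_linear : linear lmulv.
Proof.
move=> a u v; rewrite /lmulv mat_linear mulmxDr -scalemxAr vec_linear.
by [].
Qed.

HB.instance Definition _ := GRing.isLinear.Build R 'rV[R]_K 'rV[R]_K' _ lmulv lmulv_linear.

Definition lmulmx : 'M[R]_(K, K') := lin1_mx lmulv.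

Lemma mul_lmulmx w : w *m lmulmx = vec X' (A *m mat X w).
Proof. by rewrite mul_rV_lin1. Qed.

Lemma mat_lmulmx w : mat X' (w *m lmulmx) = A *m mat X w.
Proof. by rewrite mul_lmulmx vecK. Qed.

Lemma lmulmx_tr u : u *m lmulmx^T = vec X (adj A *m mat X' u).
Proof.
apply/rowP => l.
have e (w : 'rV[R]_K) : w 0 l = (w *m (delta_mx 0 l : 'rV[R]_K)^T) 0 0.
  by rewrite trmx_delta -colE mxE.
rewrite [LHS]e [RHS]e -mulmxA -trmx_mul !(mat_dot X, mat_dot X') mat_lmulmx.
by rewrite vecK ip_mull adjK.
Qed.

(** Coordinates form an isometry, so the transpose represents [adj A]. Row vectors are multiplied
    from the right, which makes this product the representation of [A *m adj A], as [gE_law]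
    requires. *)
Lemma lmulmx_orth : A *m adj A = 1%:M -> lmulmx^T *m lmulmx = 1%:M.
Proof.
move=> AA; apply/row_matrixP => i; rewrite !rowE mulmx1; move: (delta_mx _ _) => u.
by rewrite mulmxA lmulmx_tr mul_lmulmx vecK mulmxA AA mul1mx matK.
Qed.

End LeftMultiplication.

(** * Existence of polar factors *)

Section Compactness.
Variables (R : realType) (T : starField R).
Local Notation cj := (cj T).
Local Notation re := (re T).
Local Notation io := (io T).

Definition coords_enum m k : coords T m k #|{: 'I_(sdim T) * ('I_m * 'I_k)}| :=
  Coords (@enum_rankK _) (@enum_valK _).

Variable d : nat.
Let X := coords_enum d d.
Let K := #|{: 'I_(sdim T) * ('I_d * 'I_d)}|.

Let continuous_sum I (r : seq I) (f : I -> 'rV[R]_K -> R) :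
  (forall i, continuous (f i)) -> continuous (fun w => \sum_(i <- r) f i w).
Proof.
move=> cf; elim: r => [|i r IH] w.
  have -> : (fun w => \sum_(i <- [::]) f i w) = cst 0.
    by apply/funext => v; rewrite big_nil.
  exact: cst_continuous.
have -> : (fun w => \sum_(j <- i :: r) f j w) = f i \+ (fun w => \sum_(j <- r) f j w).
  by apply/funext => v; rewrite big_cons.
exact: (cvgD (cf i w) (IH w)).
Qed.

Let continuous_mul (f g : 'rV[R]_K -> R) :
  continuous f -> continuous g -> continuous (fun w => f w * g w).
Proof. by move=> cf cg w; exact: (cvgM (cf w) (cg w)). Qed.

(** In real coordinates the inner product with M is a continuous function on a compact set: the
    unitary matrices are closed, being cut out by quadratic equations, and bounded, having squared
    norm d. *)
Lemma polar_exists (M : 'M[T]_d) : exists P, is_polar M P.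
Proof.
pose U := [set w : 'rV[R]_K | unitary (mat X w)].
pose f (w : 'rV[R]_K) := ip (mat X w) M.
have cf : continuous f.
  have -> : f = fun w => \sum_l w 0 l * vec X M 0 l.
    apply/funext => w; transitivity ((w *m (vec X M)^T) 0 0).
      by rewrite (mat_dot X) vecK mxE eqxx.
    by rewrite mxE; apply: eq_bigr => l _; rewrite mxE.
  apply: continuous_sum => l; apply: continuous_mul; [exact: coord_continuous|].
  exact: cst_continuous.
have U0 : U !=set0 by exists (vec X 1%:M); rewrite /U /= vecK; exact: unitary1.
pose p (i j : 'I_d) c (w : 'rV[R]_K) : R :=
  re ((mat X w *m adj (mat X w)) i j * cj (bs c)).
have cp i j c : continuous (p i j c).
  have -> : p i j c = fun w => \sum_l \sum_a \sum_b
      w 0 (cidx X (a, (i, l))) * w 0 (cidx X (b, (j, l))) *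
      re (bs a * cj (bs b) * cj (bs c)).
    apply/funext => w; rewrite /p mxE mulr_suml raddf_sum; apply: eq_bigr => l _.
    rewrite adjE !mxE !mulr_suml raddf_sum; apply: eq_bigr => a _.
    rewrite rmorph_sum mulr_sumr mulr_suml raddf_sum; apply: eq_bigr => b _.
    by rewrite rmorphM cj_io mulrACA -rmorphM -[X in re X = _]mulrA re_io.
  apply: continuous_sum => l; apply: continuous_sum => a; apply: continuous_sum => b.
  apply: continuous_mul; last exact: cst_continuous.
  by apply: continuous_mul; exact: coord_continuous.
have clU : closed U.
  have -> : U = \bigcap_(t in [set: 'I_d * 'I_d * 'I_(sdim T)])
     (p t.1.1 t.1.2 t.2 @^-1` [set re ((t.1.1 == t.1.2)%:R * cj (bs t.2))]).
    apply/seteqP; split => [w Uw [[i j] c] _ /=|w Uw].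
      by rewrite /p Uw mxE.
    apply/matrixP => i j; rewrite [LHS]bs_expand [RHS]bs_expand; apply: eq_bigr => c _.
    by have := Uw (i, j, c) I; rewrite /= /p => ->; rewrite mxE.
  apply: closed_bigI => -[[i j] c] _ /=.
  apply: closed_comp; first by move=> w _; exact: cp.
  exact: closed_eq.
have bdU : bounded_set U.
  exists (d%:R + 1); split; first exact: num_real.
  move=> t dt w Uw; rewrite /= -[`|w|]/(mx_norm w) mx_normrE.
  apply: bigmax_le => [|[a l] _ /=]; first by rewrite (le_trans _ (ltW dt))// addr_ge0.
  rewrite ord1.
  have sqd := ip_unitary Uw; rewrite mat_sq in sqd.
  have : w 0 l ^+ 2 <= d%:R.
    by rewrite -sqd (bigD1 l)//= lerDl sumr_ge0// => i _; exact: sqr_ge0.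
  move=> w2; rewrite leNgt; apply/negP => tw.
  have dw : d%:R + 1 < `|w 0 l| := lt_trans dt tw.
  have d0 : (0 : R) <= d%:R by [].
  move: w2; rewrite -(real_normK (num_real (w 0 l))) leNgt => /negP; apply.
  move: dw d0; move: `|w 0 l| d%:R => y z; nra.
have [c Uc maxc] := EVT_max_rV U0 (bounded_closed_compact bdU clU)
  (continuous_subspaceT cf).
exists (mat X c); split; first by rewrite inE in Uc.
move=> Z hZ; have := maxc (vec X Z); rewrite /f vecK; apply.
by rewrite inE /U /= vecK.
Qed.

End Compactness.

(** * Measurability of Lipschitz functions and bounds by averaging *)

Section Lipschitz.
Variables (R : realType) (s : R).
Hypothesis s0 : s != 0.
Notation gE := (@gE R s).

Lemma rat_approx (x e : R) : 0 < e -> exists q : rat, `|x - ratr q| < e.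
Proof.
move=> e0; have /rat_in_itvoo[q] : x - e < x + e by lra.
rewrite in_itv /= => /andP[q1 q2]; exists q.
by rewrite ltr_norml; apply/andP; split; lra.
Qed.

(* {g < a} is the union over rational points q of {g q + c |. - q| < a}. *)
Lemma cmeas_lipschitz K (g : 'rV[R]_K -> R) (c : R) : 0 <= c ->
  (forall w w', g w - g w' <= c * \sum_i `|w 0 i - w' 0 i|) ->
  cmeas (fun w => (g w)%:E).
Proof.
move=> c0 gL d Z h mh; apply/measurable_EFinP.
(* An enumeration of the rational vectors; integers that encode none are sent to 0, itself
   rational. *)
pose q n : 'rV[R]_K := map_mx ratr (odflt 0 (unpickle n : option 'rV[rat]_K)).
pose k n z := g (q n) + c * \sum_i `|h i z - q n 0 i|.
have mk n : measurable_fun setT (k n).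
  apply: measurable_funD => //; apply: measurable_funM => //.
  apply: measurable_sum => i; apply: measurableT_comp => //.
  by apply: measurable_funB => //; exact: mh.
move=> mD; apply: (measurability _ (RGenInftyO.measurableE R)) => //.
move=> _ [_ [a ->] <-]; rewrite setTI.
rewrite (_ : _ @^-1` _ = \bigcup_n (k n @^-1` `]-oo, a[)); last first.
  apply/seteqP; split => z /=; rewrite in_itv /=.
    (* If every coordinate is within [e], the change of g and the penalty each cost at most c K e;
       the added 1 keeps the denominator positive and the final inequality strict. *)
    move=> ga; pose e := (a - g (\row_i h i z)) / (2 * c * K%:R + 1).
    have den0 : 0 < 2 * c * K%:R + 1 by rewrite ltr_wpDl// !mulr_ge0.
    have e0 : 0 < e by rewrite divr_gt0// subr_gt0.
    have [p pP] : {p : 'I_K -> rat | forall i, `|h i z - ratr (p i)| < e}.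
      have ex i := cid (rat_approx (h i z) e0).
      by exists (fun i => sval (ex i)) => i; exact: (svalP (ex i)).
    exists (pickle (\row_i p i)) => //=; rewrite in_itv /= /k /q pickleK /=.
    set w' := map_mx _ _.
    have S : \sum_i `|h i z - w' 0 i| <= K%:R * e.
      apply: (@le_trans _ _ (\sum_(i < K) e)).
        by apply: ler_sum => i _; rewrite !mxE ltW.
      by rewrite sumr_const card_ord mulr_natl.
    have := gL w' (\row_i h i z).
    have -> : \sum_i `|w' 0 i - (\row_i0 h i0 z) 0 i| = \sum_i `|h i z - w' 0 i|.
      by apply: eq_bigr => i _; rewrite distrC [in LHS]mxE.
    move: (\sum_i _) S => S SK gw.
    have cS : c * S <= c * (K%:R * e) by exact: ler_wpM2l.
    have eE : e * (2 * c * K%:R + 1) = a - g (\row_i h i z).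
      by rewrite divfK// gt_eqF.
    lra.
  move=> [n _] /=; rewrite in_itv /= /k => /(le_lt_trans _); apply.
  have := gL (\row_i h i z) (q n); rewrite lerBlDl => /le_trans; apply.
  rewrite lerD2l ler_wpM2l//; apply: ler_sum => i _; by rewrite [in leLHS]mxE.
apply: bigcupT_measurable => n.
by rewrite -[X in measurable X]setTI; apply: mk => //; exact: measurable_itv.
Qed.

(** By invariance all the summands F (w Q_p) have the same expectation, so a pointwise bound on
    their sum bounds |J| times E F. *)
Lemma gE_avg K (J : finType) (p0 : J) (F G : 'rV[R]_K -> R) (Q : J -> 'M[R]_K) (b : R) :
  (forall w, 0 <= F w) -> cmeas (fun w => (F w)%:E) ->
  (forall p, (Q p)^T *m Q p = 1%:M) ->
  (forall w, \sum_p F (w *m Q p) <= G w) ->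
  (gE (fun w => (G w)%:E) <= b%:E)%E ->
  (gE (fun w => (F w)%:E) <= (b / #|J|%:R)%:E)%E.
Proof.
move=> F0 mF oQ FG Gb.
have J0 : 0 < #|J|%:R :> R by rewrite ltr0n; apply/card_gt0P; exists p0.
have Ee (p : J) : gE (fun w => (F (w *m Q p))%:E) = gE (fun w => (F w)%:E).
  by apply: (gE_law s0 (oQ p) mF) => w; rewrite lee_fin.
have : (\sum_(p : J) gE (fun w => (F (w *m Q p))%:E) <= b%:E)%E.
  rewrite -gE_sum//; last 2 first.
  - by move=> p; exact: (@cmeas_lin R K K (fun w => (F w)%:E)).
  - by move=> p w; rewrite lee_fin.
  apply: le_trans Gb; apply: gE_le => w; last by rewrite sumEFin lee_fin.
  by apply: sume_ge0 => p _; rewrite lee_fin.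
under eq_bigr do rewrite Ee.
(* One summand alone shows that the expectation is finite, so that dividing by |J| makes sense. *)
have : (gE (fun w => (F w)%:E) <= b%:E)%E.
  rewrite -(Ee p0); apply: le_trans Gb; apply: gE_le => w; rewrite lee_fin//.
  by apply: le_trans (FG w); rewrite (bigD1 p0)//= lerDl sumr_ge0.
have : (0 <= gE (fun w => (F w)%:E))%E by apply: gE_ge0 => w; rewrite lee_fin.
case: (gE (fun w => (F w)%:E)) => [r _ _|_|//].
  by rewrite sumEFin !lee_fin sumr_const ler_pdivlMr// mulr_natr.
by rewrite leye_eq.
Qed.

End Lipschitz.

Section NuclearNorm.
Variables (R : realType) (T : starField R).
Local Notation re := (re T).
Local Notation io := (io T).

Definition pol d (M : 'M[T]_d) : 'M[T]_d := xget 0 [set P | is_polar M P].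

Lemma polP d (M : 'M[T]_d) : is_polar M (pol M).
Proof. by rewrite /pol; case: xgetP => // /(_ _) h; have [P /h] := polar_exists M. Qed.

Definition phi d (M : 'M[T]_d) : R := ip (pol M) M.

Lemma phi_max d (M Z : 'M[T]_d) : unitary Z -> ip Z M <= phi M.
Proof. by case: (polP M) => _; apply. Qed.

Lemma polar_phi d (M P : 'M[T]_d) : is_polar M P -> ip P M = phi M.
Proof.
move=> [hP maxP]; apply/eqP; rewrite eq_le phi_max//=; apply: maxP.
by case: (polP M).
Qed.

Lemma phi_ge0 d (M : 'M[T]_d) : 0 <= phi M.
Proof.
have h1 := phi_max M (unitary1 T d).
have h2 : ip (- 1%:M) M <= phi M.
  by apply: phi_max; rewrite /unitary adjN mulNmx mulmxN opprK unitary1.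
by move: h2; rewrite ipNl => h2; lra.
Qed.

(** The factor of A competes in the maximum defining phi B. *)
Lemma phi_sub d (A B : 'M[T]_d) : phi A - phi B <= ip (pol A) (A - B).
Proof. by rewrite ipBr /phi lerD2l lerN2; apply: phi_max; case: (polP A). Qed.

Lemma phi_le d (M : 'M[T]_d) : phi M <= (d%:R + ip M M) / 2.
Proof.
have := ip_le_half (pol M) M; rewrite (ip_unitary (proj1 (polP M))) -/(phi M) => h.
lra.
Qed.

Lemma cmeas_phi d K (X : coords T d d K) : cmeas (fun w => (phi (mat X w))%:E).
Proof.
(* The squared coordinates of a unitary matrix sum to d, so each coordinate is at most d + 1 in
   absolute value. *)
apply: (@cmeas_lipschitz R K (fun w => phi (mat X w)) (d%:R + 1)).
  by rewrite addr_ge0.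
move=> w w'; apply: le_trans (phi_sub _ _) _; rewrite -matB.
set P := pol _; have Pu : unitary P by case: (polP (mat X w)).
have -> : ip P (mat X (w - w')) = \sum_i vec X P 0 i * (w 0 i - w' 0 i).
  transitivity ((vec X P *m (w - w')^T) 0 0).
    by rewrite (mat_dot X) vecK mxE eqxx.
  by rewrite mxE; apply: eq_bigr => i _; rewrite !mxE.
rewrite mulr_sumr; apply: ler_sum => i _.
apply: le_trans (ler_norm _) _; rewrite normrM; apply: ler_wpM2r => //.
have : vec X P 0 i ^+ 2 <= d%:R.
  rewrite -(ip_unitary Pu) -[in leRHS](vecK X P) mat_sq (bigD1 i)//= lerDl.
  by apply: sumr_ge0 => j _; exact: sqr_ge0.
rewrite -(real_normK (num_real (vec X P 0 i))).
have d0 : (0 : R) <= d%:R by [].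
move: d0; move: `|vec X P 0 i| d%:R => y z z0 y2; nra.
Qed.

(* Padding [A] to a square matrix reduces this to the polar decomposition. *)
Lemma wide_polar d m (A : 'M[T]_(d, d + m)) :
  exists S : 'M[T]_d, exists2 L : 'M[T]_(d, d + m), L *m adj L = 1%:M & A = S *m L.
Proof.
pose A' : 'M[T]_(d + m) := col_mx A 0.
pose P := pol A'; have AP : is_polar A' P := polP A'.
have [hP _] := AP; have H := polar_herm AP.
have AE := polar_decomp AP.
pose S := lsubmx (A *m adj P); pose U := rsubmx (A *m adj P).
have HE : A' *m adj P = col_mx (row_mx S U) 0 by rewrite mul_col_mx mul0mx hsubmxK.
(* The lower rows of the hermitian factor vanish because those of [A'] do; by symmetry so do its
   right columns. *)
have U0 : U = 0.
  move: H; rewrite HE adj_col_mx adj_row_mx adj0 -[in LHS]col_mx0 -block_mxEh.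
  by rewrite -[in RHS]row_mx0 -block_mxEv => /eq_block_mx[_ <-].
exists S, (usubmx P).
  have := hP; rewrite /unitary -{1 2}(vsubmxK P) adj_col_mx mul_col_row.
  by rewrite [RHS]scalar_mx_block => /eq_block_mx[].
have : A' = col_mx (row_mx S 0 *m P) 0 by rewrite {1}AE HE U0 mul_col_mx mul0mx.
move=> /eq_col_mx[-> _].
by rewrite -{1}(vsubmxK P) mul_row_col mul0mx addr0.
Qed.

End NuclearNorm.

(** * Expectations and the rounding bound *)

Section Rounding.
Variables (R : realType) (T : starField R) (s : R).
Hypothesis s0 : s != 0.
Local Notation re := (re T).
Local Notation io := (io T).
Local Notation gE := (@gE R s).

Section Law.
Variables (m n k K K' : nat) (X : coords T n k K) (X' : coords T m k K').

Lemma cmeas_lmul (A : 'M[T]_(m, n)) (F : 'M[T]_(m, k) -> \bar R) :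
  cmeas (fun u => F (mat X' u)) -> cmeas (fun w => F (A *m mat X w)).
Proof.
move=> mF; have := cmeas_lin (lmulmx X X' A) mF.
by congr cmeas; apply/funext => w; rewrite mat_lmulmx.
Qed.

Lemma gE_lmul (L : 'M[T]_(m, n)) (F : 'M[T]_(m, k) -> \bar R) :
  L *m adj L = 1%:M -> cmeas (fun u => F (mat X' u)) -> (forall M, 0 <= F M)%E ->
  gE (fun w => F (L *m mat X w)) = gE (fun u => F (mat X' u)).
Proof.
move=> LL mF F0.
rewrite -(gE_law s0 (lmulmx_orth X X' LL) mF)//.
by congr gE; apply/funext => w; rewrite mat_lmulmx.
Qed.

End Law.

Lemma cmeas_ip m n k K (X : coords T n k K) (A B : 'M[T]_(m, n)) :
  cmeas (fun w => (ip (A *m mat X w) (B *m mat X w))%:E).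
Proof.
pose Y := coords_enum T m k.
have := @cmeas_sum R K _ (index_enum 'I_#|{: 'I_(sdim T) * ('I_m * 'I_k)}|)
  (fun l w => ((w *m lmulmx X Y A) 0 l)%:E * ((w *m lmulmx X Y B) 0 l)%:E)%E.
rewrite (_ : (fun w => \sum_(l <- _) _)%E =
  (fun w => (ip (A *m mat X w) (B *m mat X w))%:E)); last first.
  apply/funext => w; rewrite -!(mat_lmulmx X Y).
  transitivity (((w *m lmulmx X Y A) *m (w *m lmulmx X Y B)^T) 0 0)%:E.
    rewrite mxE -sumEFin; apply: eq_bigr => l _; rewrite EFinM.
    by congr (_ * _%:E)%E; rewrite [RHS]mxE.
  by rewrite (mat_dot Y) mxE eqxx.
apply => l; apply: cmeas_mul.
  exact: (@cmeas_lin R _ _ (fun u => (u 0 l)%:E) _ (@cmeas_coord R _ l)).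
exact: (@cmeas_lin R _ _ (fun u => (u 0 l)%:E) _ (@cmeas_coord R _ l)).
Qed.

Variables (D m : nat) (Kn Kd : nat).
Local Notation d := D.+1.
Local Notation N := (d + m)%N.
Variables (Xn : coords T N d Kn) (Xd : coords T d d Kd).

Definition nucE : \bar R := gE (fun u : 'rV_Kd => (phi (mat Xd u))%:E).

Lemma nucE_ge0 : (0 <= nucE)%E.
Proof. by apply: gE_ge0 => u; rewrite lee_fin phi_ge0. Qed.

Lemma cmeas_phi_lmul A : cmeas (fun w => (phi (A *m mat Xn w))%:E).
Proof. exact: (cmeas_lmul (F := fun M => (phi M)%:E) Xn A (cmeas_phi Xd)). Qed.

Lemma cmeas_sq K : cmeas (fun w : 'rV[R]_K => (\sum_i w 0 i ^+ 2)%:E).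
Proof.
have := @cmeas_sum R K _ (index_enum 'I_K) (fun i w => (w 0 i)%:E * (w 0 i)%:E)%E
  (fun i => cmeas_mul (@cmeas_coord R K i) (@cmeas_coord R K i)).
by congr cmeas; apply/funext => w; rewrite -sumEFin.
Qed.

Lemma nucE_fin : nucE = (fine nucE)%:E.
Proof.
apply/esym/fineK; rewrite ge0_fin_numE ?nucE_ge0//.
apply: (@le_lt_trans _ _ (gE (fun u : 'rV_Kd =>
   (d%:R)%:E + (\sum_i u 0 i ^+ 2)%:E)%E)).
  apply: gE_le => u; first by rewrite lee_fin phi_ge0.
  rewrite -EFinD lee_fin -(mat_sq Xd); apply: le_trans (phi_le _) _.
  have := ip_ge0 (mat Xd u); have : (0 : R) <= d%:R by [].
  by lra.
have sq0 (w : 'rV[R]_Kd) : (0 <= (\sum_i w 0 i ^+ 2)%:E)%E.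
  by rewrite lee_fin sumr_ge0// => i _; exact: sqr_ge0.
rewrite gE_add; do ?[exact: cmeas_cst|exact: cmeas_sq|exact: sq0|by move=> w; rewrite lee_fin].
rewrite gE_cst; apply: le_lt_trans (leeD2l _ (gE_second_moment s0 Kd)) _.
by rewrite -EFinD ltry.
Qed.

Lemma gE_scaleR K (c : R) (F : 'rV[R]_K -> R) : 0 <= c -> cmeas (fun w => (F w)%:E) ->
  (forall w, 0 <= F w) -> gE (fun w => (c * F w)%:E) = (c%:E * gE (fun w => (F w)%:E))%E.
Proof. by move=> c0 mF F0; rewrite -gE_scale// => w; rewrite lee_fin. Qed.

Lemma gE_phi_orth (L : 'M[T]_(d, N)) : L *m adj L = 1%:M ->
  gE (fun w => (phi (L *m mat Xn w))%:E) = nucE.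
Proof.
move=> LL; apply: (gE_lmul (F := fun M => (phi M)%:E) Xn (X' := Xd)) => //.
  exact: cmeas_phi.
by move=> M; rewrite lee_fin phi_ge0.
Qed.

Let J := ({ffun 'I_d -> bool} * 'I_d)%type.
Let cardJ : #|{: J}|%:R = (2 ^ d)%:R * d%:R :> R.
Proof. by rewrite card_prod card_ffun card_bool !card_ord natrM. Qed.

Lemma gE_phi_le (A : 'M[T]_(d, N)) :
  (gE (fun w => (phi (A *m mat Xn w))%:E) <=
   ((ip A A / d%:R + 1) / 2 * fine nucE)%:E)%E.
Proof.
have [S [L LL AE]] := wide_polar A.
have AA : ip A A = ip S S by rewrite AE ip_mulr -mulmxA LL mulmx1.
have mS : cmeas (fun u => (phi (S *m mat Xd u))%:E).
  exact: (cmeas_lmul (F := fun M => (phi M)%:E) Xd S (cmeas_phi Xd)).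
have -> : gE (fun w => (phi (A *m mat Xn w))%:E) =
          gE (fun u => (phi (S *m mat Xd u))%:E).
  rewrite -(gE_lmul (F := fun M => (phi (S *m M))%:E) Xn (X' := Xd) LL)//.
    by congr gE; apply/funext => w; rewrite AE mulmxA.
  by move=> M; rewrite lee_fin phi_ge0.
(* [polar_key_avg] bounds the sum of 2 phi over the shifts, hence the division by 2. *)
pose b := (2 ^ d)%:R * (ip S S + d%:R) / 2.
have b0 : 0 <= b by rewrite divr_ge0// mulr_ge0// addr_ge0// ip_ge0.
have d0 : (0 : R) < d%:R by rewrite ltr0n.
have t0 : (0 : R) < (2 ^ d)%:R by rewrite ltr0n expn_gt0.
have -> : (ip A A / d%:R + 1) / 2 * fine nucE = b * fine nucE / #|{: J}|%:R.
  by rewrite AA cardJ /b; field; rewrite !gt_eqF.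
apply: (@gE_avg R s s0 Kd J ([ffun=> false], ord0) _ (fun u => b * phi (mat Xd u))
   (fun p => lmulmx Xd Xd (sgshift T p.1 p.2))) => //.
- by move=> w; exact: phi_ge0.
- by move=> p; apply: lmulmx_orth; exact: sgshift_unitary.
- move=> w.
  (* Each shifted product receives its own polar factor, so that every term on the left is a value
     of phi. *)
  have := polar_key_avg S (polP (mat Xd w))
    (fun eps j => proj1 (polP (S *m sgshift T eps j *m mat Xd w))).
  rewrite pair_bigA /= -mulr_sumr => h.
  rewrite -(ler_pM2l (ltr0Sn R 1)); apply: le_trans (le_trans _ h) _.
    rewrite le_eqVlt; apply/orP; left; apply/eqP; congr (_ * _).
    by apply: eq_bigr => p _; rewrite mat_lmulmx /phi !mulmxA.
  by rewrite /b /phi; lra.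
- rewrite gE_scaleR//; last by move=> w; exact: phi_ge0.
    by rewrite -/nucE {1}nucE_fin -EFinM.
  exact: cmeas_phi.
Qed.

Let JN := ({ffun 'I_(D + m).+1 -> bool} * 'I_(D + m).+1)%type.
Let cardJN : #|{: JN}|%:R = (2 ^ N)%:R * N%:R :> R.
Proof. by rewrite card_prod card_ffun card_bool !card_ord natrM. Qed.

(** The normalisation says that the random matrix has squared norm N in mean. By [trace_avg] the
    orbit sum of the form is 2^N |G|^2 re (tr Q), and dividing by the 2^N N shifts leaves the
    trace. *)
Lemma gE_quad (Q : 'M[T]_N) : Kn%:R * s ^+ 2 = N%:R ->
  (forall k (G : 'M[T]_(N, k)), 0 <= ip (Q *m G) G) ->
  (gE (fun w => (ip (Q *m mat Xn w) (mat Xn w))%:E) <= (re (\tr Q))%:E)%E.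
Proof.
move=> sN Q0.
have trQ : 0 <= re (\tr Q) by have := Q0 _ 1%:M; rewrite mulmx1 ip1.
have N0 : (0 : R) < N%:R by rewrite ltr0n.
have t0 : (0 : R) < (2 ^ N)%:R by rewrite ltr0n expn_gt0.
pose b := (2 ^ N)%:R * re (\tr Q).
have -> : re (\tr Q) = b * N%:R / #|{: JN}|%:R.
  by rewrite cardJN /b; field; rewrite !gt_eqF.
apply: (@gE_avg R s s0 Kn JN ([ffun=> false], ord0)
   (fun w => ip (Q *m mat Xn w) (mat Xn w)) (fun w => b * \sum_i w 0 i ^+ 2)
   (fun p => lmulmx Xn Xn (sgshift T p.1 p.2))) => //.
- by have := @cmeas_ip N N d Kn Xn Q 1%:M; congr cmeas; apply/funext => w; rewrite mul1mx.
- by move=> p; apply: lmulmx_orth; exact: sgshift_unitary.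
- move=> w; rewrite -(mat_sq Xn).
  have := trace_avg (D := (D + m)%N) Q (mat Xn w).
  rewrite pair_bigA /= => h; rewrite le_eqVlt; apply/orP; left; apply/eqP.
  rewrite /b mulrAC -h; apply: eq_bigr => p _.
  by rewrite mat_lmulmx.
- rewrite gE_scaleR//; last 3 first.
  + by rewrite /b mulr_ge0.
  + exact: cmeas_sq.
  + by move=> w; rewrite sumr_ge0// => i _; exact: sqr_ge0.
  rewrite (EFinM b); apply: lee_wpmul2l; first by rewrite lee_fin /b mulr_ge0.
  by rewrite -sN; exact: gE_second_moment.
Qed.

End Rounding.

(** * Stacking and splitting block rows *)

Section Blocks.
Variables (R : realType) (T : starField R) (n d : nat).
Hypothesis d0 : (0 < d)%N.

Lemma unbidx_ltn (r : 'I_(n * d)) : (r %/ d < n)%N.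
Proof. by rewrite ltn_divLR. Qed.

Lemma unbidx_mod (r : 'I_(n * d)) : (r %% d < d)%N.
Proof. by rewrite ltn_pmod. Qed.

Definition unbidx (r : 'I_(n * d)) : 'I_n * 'I_d :=
  (Ordinal (unbidx_ltn r), Ordinal (unbidx_mod r)).

Lemma bidxK (p : 'I_n * 'I_d) : unbidx (bidx p.1 p.2) = p.
Proof.
case: p => i a; congr pair; apply: val_inj => /=.
  by rewrite divnMDl// divn_small ?addn0.
by rewrite modnMDl modn_small.
Qed.

Lemma unbidxK (r : 'I_(n * d)) : bidx (unbidx r).1 (unbidx r).2 = r.
Proof. by apply: val_inj => /=; rewrite -divn_eq. Qed.

Lemma sum_bidx (V : nmodType) (F : 'I_(n * d) -> V) :
  \sum_r F r = \sum_i \sum_a F (bidx i a).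
Proof.
rewrite (pair_bigA _ (fun i a => F (bidx i a))) /= (reindex (fun p => bidx p.1 p.2))//.
by exists unbidx => ? _; [exact: bidxK|exact: unbidxK].
Qed.

Definition blk k (i : 'I_n) (W : 'M[T]_(n * d, k)) : 'M[T]_(d, k) :=
  \matrix_(a, l) W (bidx i a) l.

Definition stk k (V : 'I_n -> 'M[T]_(d, k)) : 'M[T]_(n * d, k) :=
  \matrix_(r, l) V (unbidx r).1 (unbidx r).2 l.

Lemma stkK k (V : 'I_n -> 'M[T]_(d, k)) i : blk i (stk V) = V i.
Proof. by apply/matrixP => a l; rewrite !mxE (bidxK (i, a)). Qed.

Lemma ip_blk k (V W : 'M[T]_(n * d, k)) : ip V W = \sum_i ip (blk i V) (blk i W).
Proof.
rewrite ipE sum_bidx; apply: eq_bigr => i _; rewrite ipE.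
by apply: eq_bigr => a _; apply: eq_bigr => l _; rewrite !mxE.
Qed.

Lemma blkM k l i (V : 'M[T]_(n * d, k)) (G : 'M[T]_(k, l)) :
  blk i (V *m G) = blk i V *m G.
Proof.
by apply/matrixP => a b; rewrite !mxE; apply: eq_bigr => c _; rewrite !mxE.
Qed.

End Blocks.

(** * Lower bound for the expected rounded objective *)

Section Main.
Variables (R : realType) (T : starField R) (s : R).
Hypothesis s0 : s != 0.
Local Notation re := (re T).
Local Notation io := (io T).
Local Notation gE := (@gE R s).
Variables (D n' : nat) (Kn Kd : nat).
Local Notation d := D.+1.
Local Notation n := n'.+1.
Local Notation N := (n * d)%N.
Variables (Xn : coords T N d Kn) (Xd : coords T d d Kd).
Hypothesis sN : Kn%:R * s ^+ 2 = N%:R.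
Let d0 : (0 < d)%N := ltn0Sn D.

Variable C : 'M[T]_N.
Hypothesis Cherm : adj C = C.
Hypothesis Cpsd : forall k (V : 'M[T]_(N, k)), 0 <= ip (C *m V) V.
Variable X : 'I_n -> 'M[T]_(d, N).
Hypothesis XX : forall i, X i *m adj (X i) = 1%:M.

Local Notation st := (@stk R T n d d0 _).
Let B i : 'M[T]_(d, N) := blk i (C *m st X).
Let Q : 'M[T]_N := adj (st X) *m C *m st X.
Let A (t : R) i : 'M[T]_(d, N) := X i - io t *: B i.
Let tau := ip (C *m st X) (st X).
Let beta := \sum_i ip (B i) (B i).

(* Positivity of the form at [V - a W], where [W] stacks the X_i G, together with
   convexity of [phi] at X_i G, of which V_i is a subgradient. *)
Lemma rounding_lower (a t : R) (G : 'M[T]_(N, d)) (V : 'I_n -> 'M[T]_d) :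
  0 <= a -> 0 < t -> (forall i, is_polar (X i *m G) (V i)) ->
  2 * a / t * \sum_i phi (X i *m G) <=
  ip (C *m st V) (st V) + (2 * a / t * (\sum_i phi (A t i *m G)) +
    a ^+ 2 * ip (Q *m G) G).
Proof.
move=> a0 t0 VP; pose W := st X *m G.
have := Cpsd (st V - io a *: W).
rewrite mulmxBr -scalemxAr ipBl !ipBr !ipZl !ipZr.
have -> : ip (C *m W) W = ip (Q *m G) G.
  by rewrite /Q /W -!mulmxA [RHS]ip_mull adjK.
have -> : ip (C *m st V) W = ip (C *m W) (st V) by rewrite ip_mull Cherm ipC.
have E1 : ip (C *m W) (st V) = \sum_i ip (V i) (B i *m G).
  by rewrite ipC (ip_blk d0); apply: eq_bigr => i _; rewrite stkK /W mulmxA blkM.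
have E2 : \sum_i phi (X i *m G) - \sum_i phi (A t i *m G) <=
    t * \sum_i ip (V i) (B i *m G).
  rewrite -sumrB mulr_sumr; apply: ler_sum => i _.
  have [hV _] := VP i; rewrite -(polar_phi (VP i)).
  have := phi_max (A t i *m G) hV; rewrite /A mulmxBl -scalemxAl ipBr ipZr.
  lra.
rewrite E1; move: (\sum_i _) (\sum_i _) (\sum_i _) E2 => x z y E2 h.
have E3 : 2 * a / t * (y - z) <= 2 * a * x.
  apply: le_trans (_ : 2 * a / t * (t * x) <= _).
    apply: ler_wpM2l; last exact: E2.
    by apply: divr_ge0; [apply: mulr_ge0|exact: ltW].
  by rewrite mulrA divfK ?gt_eqF.
move: h E3; move: (2 * a / t) => c h E3; nra.
Qed.

(** [n * d] is convertible to [d + m], the shape to which [wide_polar] and the bounds on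
    expectations apply. *)
Local Notation m := (n' * d)%N.
Let phim (L : 'M[T]_(d, N)) : cmeas (fun w => (phi (L *m mat Xn w))%:E).
Proof. exact: (@cmeas_phi_lmul R T D m Kn Kd Xn Xd L). Qed.

Let nE : \bar R := nucE s Xd.

Lemma trQ : re (\tr Q) = tau.
Proof. by rewrite /Q -mulmxA mxtrace_mulC. Qed.

Lemma sum_ipXB : \sum_i ip (X i) (B i) = tau.
Proof.
by rewrite /tau ipC (ip_blk d0); apply: eq_bigr => i _; rewrite stkK.
Qed.

Lemma cmeas_sumR I (r : seq I) K (F : I -> 'rV[R]_K -> R) :
  (forall i, cmeas (fun w => (F i w)%:E)) -> cmeas (fun w => (\sum_(i <- r) F i w)%:E).
Proof.
move=> mF; have := cmeas_sum r mF.
by congr cmeas; apply/funext => w; rewrite sumEFin.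
Qed.

Lemma gE_sumR I (r : seq I) K (F : I -> 'rV[R]_K -> R) :
  (forall i, cmeas (fun w => (F i w)%:E)) -> (forall i w, 0 <= F i w) ->
  gE (fun w => (\sum_(i <- r) F i w)%:E) = (\sum_(i <- r) gE (fun w => (F i w)%:E))%E.
Proof.
move=> mF F0; rewrite -gE_sum//.
by congr gE; apply/funext => w; rewrite sumEFin.
Qed.

Lemma cmeas_scaleR K (c : R) (F : 'rV[R]_K -> R) :
  cmeas (fun w => (F w)%:E) -> cmeas (fun w => (c * F w)%:E).
Proof. by move=> mF; have := cmeas_mul (@cmeas_cst R K c%:E) mF. Qed.

(** With a = E phi(G) / d and c = 2 a / t, the difference of the expectations of phi contributes c
    (t tau / d - t^2 beta / (2 d)) E phi(G) = 2 a^2 tau - t a^2 beta, and the quadratic term costs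
    a^2 tau. *)
Lemma gE_rounding_step (t : R) (V : 'M[T]_(N, d) -> 'I_n -> 'M[T]_d) : 0 < t ->
  (forall G i, is_polar (X i *m G) (V G i)) ->
  (((fine nE / d%:R) ^+ 2 * tau - t * ((fine nE / d%:R) ^+ 2 * beta))%:E <=
   gE (fun w => (ip (C *m st (V (mat Xn w))) (st (V (mat Xn w))))%:E))%E.
Proof.
move=> t0 VP; set a := fine nE / d%:R.
have pb0 : 0 <= fine nE by rewrite fine_ge0// nucE_ge0.
have a0 : 0 <= a by rewrite divr_ge0.
pose c := 2 * a / t; have c0 : 0 <= c by rewrite divr_ge0 ?mulr_ge0// ltW.
pose v w := c * \sum_i phi (X i *m mat Xn w).
pose q w := ip (Q *m mat Xn w) (mat Xn w).
pose u w := c * (\sum_i phi (A t i *m mat Xn w)) + a ^+ 2 * q w.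
pose f w := ip (C *m st (V (mat Xn w))) (st (V (mat Xn w))).
(* Both 0 and v - u lie below the objective f, and [gE_le] needs a nonnegative lower function. *)
pose h w := Num.max 0 (v w - u w).
have sphi0 (L : 'I_n -> 'M[T]_(d, N)) w : 0 <= \sum_i phi (L i *m mat Xn w).
  by apply: sumr_ge0 => i _; exact: phi_ge0.
have Q0 k (G : 'M[T]_(N, k)) : 0 <= ip (Q *m G) G.
  by rewrite /Q -!mulmxA ip_mull adjK.
have q0 w : 0 <= q w by exact: Q0.
have u10 w : 0 <= c * (\sum_i phi (A t i *m mat Xn w)).
  exact: mulr_ge0 c0 (sphi0 (A t) w).
have u20 w : 0 <= a ^+ 2 * q w by exact: mulr_ge0 (sqr_ge0 a) (q0 w).
have u0 w : 0 <= u w by exact: addr_ge0 (u10 w) (u20 w).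
have h0 w : 0 <= h w by rewrite le_max lexx.
have mphi (L : 'I_n -> 'M[T]_(d, N)) : cmeas (fun w => (\sum_i phi (L i *m mat Xn w))%:E).
  by apply: cmeas_sumR => i; exact: phim.
have mq : cmeas (fun w => (q w)%:E).
  have := @cmeas_ip R T N N d Kn Xn Q 1%:M.
  by congr cmeas; apply/funext => w; rewrite mul1mx.
have mv : cmeas (fun w => (v w)%:E) by exact: cmeas_scaleR.
have mu1 : cmeas (fun w => (c * (\sum_i phi (A t i *m mat Xn w)))%:E).
  exact: cmeas_scaleR.
have mu2 : cmeas (fun w => (a ^+ 2 * q w)%:E) by exact: cmeas_scaleR.
have mu : cmeas (fun w => (u w)%:E) by exact: (cmeas_add mu1 mu2).
have mh : cmeas (fun w => (h w)%:E).
  move=> dd Z hh mhh; apply/measurable_EFinP; apply: measurable_maxr => //.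
  by apply: measurable_funB; apply/measurable_EFinP; [exact: mv|exact: mu].
have hf : (gE (fun w => (h w)%:E) <= gE (fun w => (f w)%:E))%E.
  apply: gE_le => w; rewrite lee_fin// /h ge_max Cpsd /= lerBlDr.
  exact: (rounding_lower a0 t0 (VP (mat Xn w))).
apply: le_trans hf.
have vE : gE (fun w => (v w)%:E) = (c * (n%:R * fine nE))%:E.
  rewrite gE_scaleR// gE_sumR//; last by move=> i w; exact: phi_ge0.
  under eq_bigr do rewrite (@gE_phi_orth R T s s0 D m Kn Kd Xn Xd _ (XX _)).
  rewrite (EFinM c); congr (_ * _)%E.
  rewrite (eq_bigr (fun=> (fine nE)%:E)); last by move=> i _; exact: nucE_fin.
  by rewrite sumEFin sumr_const card_ord mulr_natl.
pose r := \sum_i (ip (A t i) (A t i) / d%:R + 1) / 2.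
have uE : (gE (fun w => (u w)%:E) <= (c * (r * fine nE) + a ^+ 2 * tau)%:E)%E.
  rewrite (_ : gE _ = gE (fun w => (c * (\sum_i phi (A t i *m mat Xn w)))%:E) +
      gE (fun w => (a ^+ 2 * q w)%:E))%E; last first.
    by rewrite -gE_add// => w; rewrite lee_fin.
  rewrite EFinD; apply: leeD.
    rewrite gE_scaleR// (EFinM c); apply: lee_wpmul2l; first by rewrite lee_fin.
    rewrite gE_sumR//; last by move=> i w; exact: phi_ge0.
    rewrite /r mulr_suml -sumEFin; apply: lee_sum => i _.
    exact: (@gE_phi_le R T s s0 D m Kn Kd Xn Xd).
  rewrite gE_scaleR ?sqr_ge0// (EFinM (a ^+ 2));
    apply: lee_wpmul2l; first by rewrite lee_fin sqr_ge0.
  by rewrite -trQ; exact: (@gE_quad R T s s0 D m Kn Xn Q sN Q0).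
(* Written additively, as v <= h + u, so that expectations are only ever taken of nonnegative
   functions. *)
have vhu : (gE (fun w => (v w)%:E) <= gE (fun w => (h w)%:E) + gE (fun w => (u w)%:E))%E.
  rewrite -gE_add//; do ?[by move=> w; rewrite lee_fin].
  apply: gE_le => w; first by rewrite lee_fin mulr_ge0.
  rewrite -EFinD lee_fin -lerBlDr.
  by rewrite le_max lexx orbT.
have : (gE (fun w => (v w)%:E) <= gE (fun w => (h w)%:E) +
    (c * (r * fine nE) + a ^+ 2 * tau)%:E)%E.
  by apply: le_trans vhu _; exact: leeD2l.
rewrite vE -leeBlDr// -EFinB; apply: le_trans.
have dn0 : d%:R != 0 :> R by rewrite pnatr_eq0.
(* Since |X_i|^2 = d, each term equals 1 at order zero; the n cancels against the expectation of
   v. *)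
have rE : r = n%:R - t / d%:R * tau + t ^+ 2 / (2 * d%:R) * beta.
  rewrite /r -sum_ipXB /beta !mulr_sumr -sumrN.
  have -> : n%:R = \sum_(i < n) 1 :> R by rewrite sumr_const card_ord.
  rewrite -!big_split /=; apply: eq_bigr => i _.
  rewrite /A ip_sqB ipZr ipZl ipZr (ip_unitary (XX i)).
  by move: (d%:R) dn0 => x x0; field.
rewrite lee_fin rE /c /a le_eqVlt; apply/orP; left; apply/eqP.
move: (d%:R) (n%:R) dn0 => x y x0; field.
by rewrite x0 gt_eqF.
Qed.

Lemma gE_rounding (V : 'M[T]_(N, d) -> 'I_n -> 'M[T]_d) :
  (forall G i, is_polar (X i *m G) (V G i)) ->
  (((fine nE / d%:R) ^+ 2 * tau)%:E <=
   gE (fun w => (ip (C *m st (V (mat Xn w))) (st (V (mat Xn w))))%:E))%E.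
Proof.
move=> VP; apply/lee_addgt0Pr => e e0.
pose c := (fine nE / d%:R) ^+ 2 * beta.
have c0 : 0 <= c by rewrite mulr_ge0 ?sqr_ge0// sumr_ge0// => i _; exact: ip_ge0.
(* For t = e / (c + 1) the loss t c is at most e. *)
have t0 : 0 < e / (c + 1) by rewrite divr_gt0// ltr_wpDl.
rewrite -leeBlDr// -EFinB; apply: le_trans (gE_rounding_step t0 VP).
rewrite lee_fin lerD2l lerN2 -/c mulrAC ler_pdivrMr ?ltr_wpDl//.
by rewrite mulrDr mulr1 lerDl ltW.
Qed.

End Main.

(** * The real and complex cases *)

Section Transfer.
Variables (R : realType) (s : R).

(* [gE] integrates coordinate 0 outermost and [gexp] the last one, hence [rev_ord]. *)
Definition unv k (w : 'rV[R]_k) (i : nat) : R :=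
  if insub i is Some o then w 0 (rev_ord o) else 0.

Lemma unv_row_mx k (x : R) (w : 'rV[R]_k) :
  unv (row_mx x%:M w : 'rV_(1 + k)) = (fun i => if i == k then x else unv w i).
Proof.
apply/funext => i; rewrite /unv.
case: insubP => [l _ li|]; last first.
  rewrite -leqNgt => ki; rewrite gtn_eqF// insubN// -leqNgt.
  exact: ltnW.
rewrite mxE; case: fintype.splitP => j /=; rewrite li.
  rewrite ord1 mxE /= => /eqP; rewrite subn_eq0 => ki.
  have ik : (i <= k)%N by rewrite -ltnS -li; exact: ltn_ord.
  have -> : i = k by apply/eqP; rewrite eqn_leq ik; exact: ki.
  by rewrite eqxx.
rewrite subSS => e.
have ik : (i < k)%N by rewrite -subn_gt0 e.
rewrite (ltn_eqF ik); case: insubP => [l' _ li'|]; last by rewrite ik.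
congr (w 0 _); apply: val_inj => /=; rewrite li' subnS e.
by [].
Qed.

Lemma gexpE k (F : (nat -> R) -> \bar R) :
  gexp s k F = gE s (fun w : 'rV_k => F (unv w)).
Proof.
elim: k F => [|k IH] F /=.
  by congr F; apply/funext => i; rewrite /unv; case: insubP => [[]|].
apply: eq_integral => x _; rewrite IH; congr gE; apply/funext => w.
by rewrite unv_row_mx.
Qed.

End Transfer.

(** * Nearest unitary matrices, singular values and block objectives *)

Section ObjectiveBound.
Variables (R : realType) (T : starField R).
Local Notation re := (re T).
Local Notation io := (io T).

(** All unitary matrices have squared norm d, so the distance to X depends only on the inner product
    with X. *)
Lemma polar_argmin d (X P : 'M[T]_d) :
  unitary P -> (forall Z, unitary Z ->
    Num.sqrt (ip (P - X) (P - X)) <= Num.sqrt (ip (Z - X) (Z - X))) <->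
  (forall Z, unitary Z -> ip Z X <= ip P X).
Proof.
move=> hP; split=> h Z hZ; move: (h Z hZ).
  rewrite ler_sqrt ?ip_ge0// !ip_sqB (ip_unitary hP) (ip_unitary hZ).
  by move=> h'; lra.
by move=> h'; rewrite ler_sqrt ?ip_ge0// !ip_sqB (ip_unitary hP) (ip_unitary hZ); lra.
Qed.

(** Minimisers exist by [polar_exists], so [xget] never returns its default 0. *)
Lemma argmin_is_polar d (X : 'M[T]_d) (frob : 'M[T]_d -> R) :
  (forall A, frob A = Num.sqrt (ip A A)) ->
  is_polar X (xget 0 [set Z | unitary Z /\
    forall Z', unitary Z' -> frob (Z - X) <= frob (Z' - X)]).
Proof.
move=> frobE; case: xgetP => [P _ [hP minP]|h].
  split=> //; apply/(polar_argmin X hP) => Z hZ; rewrite -!frobE; exact: minP.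
have [P [hP maxP]] := polar_exists X; case: (h P); split=> // Z hZ.
by rewrite !frobE; apply/(polar_argmin X hP) : Z hZ.
Qed.

Lemma svd_trace d (G U V : 'M[T]_d) (sv : 'rV[R]_d) : unitary U -> unitary V ->
  G = U *m diag_mx (\row_j io (sv 0 j)) *m adj V ->
  \sum_j sv 0 j = ip (U *m adj V) G.
Proof.
move=> hU hV ->; pose Dg := diag_mx (\row_j io (sv 0 j)); rewrite -/Dg.
rewrite ip_mulr adjK -!mulmxA unitary_adj// mulmx1 -[U in ip U _]mulmx1 ip_unitaryl//.
rewrite ipC ip1 /mxtrace raddf_sum; apply: eq_bigr => j _.
by rewrite !mxE eqxx mulr1n re_io_id.
Qed.

(** A sum of singular values is the inner product of G with the unitary matrix U V^*, hence at most
    phi G. If [xget] falls back on the zero row, the sum is 0 and the bounds still hold. *)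
Lemma svd_trace_le d (G : 'M[T]_d) (P : 'rV[R]_d -> Prop) :
  (forall sv, P sv -> (forall j, 0 <= sv 0 j) /\ exists U V : 'M[T]_d,
     unitary U /\ unitary V /\ G = U *m diag_mx (\row_j io (sv 0 j)) *m adj V) ->
  0 <= \sum_j (xget 0 [set sv | P sv]) 0 j <= phi G.
Proof.
move=> PE; case: xgetP => [sv _ /PE[sv0 [U [V [hU [hV GE]]]]]|_].
  rewrite sumr_ge0//= (svd_trace hU hV GE); apply: phi_max.
  exact: unitaryM hU (unitary_adjP hV).
by rewrite big1 ?lexx ?phi_ge0// => j _; rewrite mxE.
Qed.

Lemma ip_col m k (A B : 'M[T]_(m, k)) : ip A B = \sum_l ip (col l A) (col l B).
Proof.
rewrite ipE exchange_big; apply: eq_bigr => l _; rewrite ipE.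
by apply: eq_bigr => i _; rewrite big_ord1 !mxE.
Qed.

Variables (n d : nat).
Hypothesis d0 : (0 < d)%N.

Definition cblk (C : 'M[T]_(n * d)) (i j : 'I_n) : 'M[T]_d :=
  \matrix_(a, b) C (bidx i a) (bidx j b).

Lemma blk_mul_stk k (C : 'M[T]_(n * d)) (V : 'I_n -> 'M[T]_(d, k)) i :
  blk i (C *m stk d0 V) = \sum_j cblk C i j *m V j.
Proof.
apply/matrixP => a l; rewrite !mxE (sum_bidx d0) summxE; apply: eq_bigr => j _.
rewrite mxE; apply: eq_bigr => b _; rewrite !mxE.
by rewrite (bidxK d0 (j, b)).
Qed.

Lemma objective_ip k (C : 'M[T]_(n * d)) (V : 'I_n -> 'M[T]_(d, k)) :
  \sum_i \sum_j re (\tr (adj (cblk C i j) *m V i *m adj (V j))) =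
  ip (C *m stk d0 V) (stk d0 V).
Proof.
rewrite (ip_blk d0); apply: eq_bigr => i _.
rewrite blk_mul_stk stkK ip_suml; apply: eq_bigr => j _.
by rewrite -/(ip _ _) ip_mull adjK ipC.
Qed.

End ObjectiveBound.

Section FinalBound.
Variables (R : realType) (T : starField R) (s : R).
Hypothesis s0 : s != 0.
Local Notation io := (io T).
Variables (D n' : nat) (Kn Kd : nat).
Local Notation d := D.+1.
Local Notation n := n'.+1.
Local Notation N := (n * d)%N.
Variables (Xn : coords T N d Kn) (Xd : coords T d d Kd).
Hypothesis sN : Kn%:R * s ^+ 2 = N%:R.
Let d0 : (0 < d)%N := ltn0Sn D.

Lemma rounding_ratio (C : 'M[T]_N) (X : 'I_n -> 'M[T]_(d, N)) (O : 'I_n -> 'M[T]_d)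
    (V : 'M[T]_(N, d) -> 'I_n -> 'M[T]_d) (sv : 'M[T]_d -> R) :
  adj C = C -> (forall v : 'cV[T]_N, 0 <= ip (C *m v) v) ->
  (forall i, X i *m adj (X i) = 1%:M) ->
  (forall X' : 'I_n -> 'M[T]_(d, N), (forall i, X' i *m adj (X' i) = 1%:M) ->
     ip (C *m stk d0 X') (stk d0 X') <= ip (C *m stk d0 X) (stk d0 X)) ->
  (forall i, unitary (O i)) ->
  (forall G i, is_polar (X i *m G) (V G i)) ->
  (forall G, 0 <= sv G <= phi G) ->
  (gE s (fun u => (d%:R^-1 * sv (mat Xd u))%:E) *
   gE s (fun u => (d%:R^-1 * sv (mat Xd u))%:E) *
   (ip (C *m stk d0 O) (stk d0 O))%:E <=
   gE s (fun w => (ip (C *m stk d0 (V (mat Xn w))) (stk d0 (V (mat Xn w))))%:E))%E.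
Proof.
move=> Ch Cp XX Xmax hO VP svP; set al := gE s _.
(* The form on matrices is the sum of its values on the columns. *)
have Cpsd k (W : 'M[T]_(N, k)) : 0 <= ip (C *m W) W.
  rewrite ip_col; apply: sumr_ge0 => l _.
  by rewrite colE -mulmxA -colE.
have pb0 : 0 <= fine (nucE s Xd) by rewrite fine_ge0// nucE_ge0.
have di0 : (0 : R) <= d%:R^-1 by rewrite invr_ge0.
have al0 : (0 <= al)%E.
  by apply: gE_ge0 => u; rewrite lee_fin mulr_ge0//; case/andP: (svP (mat Xd u)).
have al1 : (al <= (fine (nucE s Xd) / d%:R)%:E)%E.
  apply: (@le_trans _ _ (gE s (fun u => (d%:R^-1 * phi (mat Xd u))%:E))).
    apply: gE_le => u; case/andP: (svP (mat Xd u)) => ? ?.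
      by rewrite lee_fin mulr_ge0.
    by rewrite lee_fin ler_wpM2l.
  rewrite gE_scaleR//; last by move=> u; exact: phi_ge0.
    by rewrite -/(nucE s Xd) nucE_fin// -EFinM mulrC.
  exact: cmeas_phi.
have OX : ip (C *m stk d0 O) (stk d0 O) <= ip (C *m stk d0 X) (stk d0 X).
  (* Zero columns make O feasible for the relaxation and leave all products O_i O_j^*, hence the
     objective, unchanged. *)
  pose X' i : 'M[T]_(d, d + n' * d) := row_mx (O i) 0.
  have X'E i j : X' i *m adj (X' j) = O i *m adj (O j).
    by rewrite /X' adj_row_mx mul_row_col mul0mx addr0.
  have X'1 i : X' i *m adj (X' i) = 1%:M by rewrite X'E; exact: hO.
  apply: le_trans (Xmax X' X'1); rewrite -!(objective_ip d0).
  rewrite le_eqVlt; apply/orP; left; apply/eqP.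
  apply: eq_bigr => i _; apply: eq_bigr => j _; rewrite -!mulmxA.
  by congr (re _ (\tr (_ *m _))); rewrite -X'E.
apply: le_trans (gE_rounding s0 Xn Xd sN Ch Cpsd XX VP).
rewrite EFinM expr2 EFinM.
by apply: lee_pmul; rewrite ?mule_ge0// ?lee_fin// lee_pmul.
Qed.

End FinalBound.

(** * The real and complex fields, and their Gaussian coordinates *)

Section Instances.
Variable R : realType.

Lemma real_bs_expand (x : R) :
  x = \sum_(k < 1) idfun (idfun (x * idfun (1 : R))) * 1.
Proof. by rewrite big_ord1 /= !mulr1. Qed.

Lemma real_bs_orth (k l : 'I_1) : idfun (1 * idfun (1 : R)) = (k == l)%:R :> R.
Proof. by rewrite (ord1 k) (ord1 l) eqxx /= mulr1. Qed.

Definition realStar : starField R :=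
  @StarField R R idfun idfun idfun 1 (fun _ => 1)
    (fun _ => erefl) (fun _ => erefl) (fun _ _ => erefl) (fun _ => erefl)
    real_bs_expand real_bs_orth (fun _ _ => erefl).

Lemma complex_Re_additive : additive (@complex.Re R : R[i] -> R).
Proof. by move=> [a b] [c e]. Qed.

HB.instance Definition _ := GRing.isAdditive.Build R[i] R (@complex.Re R) complex_Re_additive.

Definition cbasis (k : 'I_2) : R[i] := if k == 0 then 1 else 'i%C.

Lemma complex_Re_conj (x : R[i]) : complex.Re (conjc x) = complex.Re x.
Proof. by case: x. Qed.

Lemma complex_Re_real (r : R) (x : R[i]) :
  complex.Re (real_complex R r * x) = r * complex.Re x.
Proof. by case: x => a b /=; rewrite mul0r subr0. Qed.

Lemma complex_conj_real (r : R) : conjc (real_complex R r) = real_complex R r.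
Proof. by rewrite /= oppr0. Qed.

Lemma complex_bs_expand (x : R[i]) :
  x = \sum_k real_complex R (complex.Re (x * conjc (cbasis k))) * cbasis k.
Proof.
case: x => a b; rewrite big_ord_recl big_ord1 /cbasis /=.
by apply/eqP; rewrite eq_complex /=; apply/andP; split; apply/eqP; ring.
Qed.

Lemma complex_bs_orth (k l : 'I_2) :
  complex.Re (cbasis k * conjc (cbasis l)) = (k == l)%:R.
Proof.
rewrite /cbasis; case: k => [[|[|//]] ?]; case: l => [[|[|//]] ?] /=; ring.
Qed.

Lemma complex_conj_self (x : R[i]) : conjc x = x -> x = real_complex R (complex.Re x).
Proof.
case: x => a b /= [] e; congr Complex; lra.
Qed.

Definition complexStar : starField R :=
  @StarField R R[i] (@conjc R) (@complex.Re R) (real_complex R) 2 cbasis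
    (@conjcK R) complex_Re_conj complex_Re_real complex_conj_real
    complex_bs_expand complex_bs_orth complex_conj_self.

End Instances.

Section RealCase.
Variable R : realType.
Local Notation T := (realStar R).

Lemma unv_ord k (w : 'rV[R]_k) (l : 'I_k) : unv w l = w 0 (rev_ord l).
Proof. by rewrite /unv valK. Qed.

Lemma adj_real m k (A : 'M[R]_(m, k)) : adj (A : 'M[T]_(m, k)) = A^T.
Proof. by apply/matrixP => i j; rewrite !mxE. Qed.

Lemma frob_real d (A : 'M[R]_d) : frobR A = Num.sqrt (ip (A : 'M[T]_d) A).
Proof.
rewrite /frobR ipE; congr Num.sqrt; by apply: eq_bigr => i _; apply: eq_bigr.
Qed.

Lemma unitary_real d (Z : 'M[R]_d) : unitary (Z : 'M[T]_d) = orthogonalR Z.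
Proof. by rewrite /unitary adj_real. Qed.

Lemma polar_real d (M : 'M[R]_d) : is_polar (M : 'M[T]_d) (polarR M).
Proof.
have := @argmin_is_polar R T d M (@frobR R d d) (@frob_real d).
congr (is_polar _ (xget _ _)); apply/funext => Z /=.
rewrite unitary_real; congr (_ /\ _); apply: eq_forall => Z'.
by rewrite unitary_real.
Qed.

Lemma sv_real d (G : 'M[R]_d) : 0 <= sv_sumR G <= phi (G : 'M[T]_d).
Proof.
apply: (@svd_trace_le R T) => sv [sv0 [U [V [hU [hV ->]]]]]; split=> //.
exists U, V; rewrite !unitary_real adj_real; split=> //; split=> //.
by congr (_ *m diag_mx _ *m _); apply/rowP => j; rewrite mxE.
Qed.

Lemma obj_real n d k (d0 : (0 < d)%N) (C : 'M[R]_(n * d)) (V : 'I_n -> 'M[R]_(d, k)) :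
  objR C V = ip ((C : 'M[T]_(n * d)) *m stk (T := T) d0 V) (stk (T := T) d0 V).
Proof.
rewrite -(objective_ip (T := T) d0); apply: eq_bigr => i _; apply: eq_bigr => j _.
by rewrite !adj_real.
Qed.

Variables (m d : nat) (d0 : (0 < d)%N).

(** [rev_ord] undoes the reversal in [unv]. *)
Definition real_cidx (p : 'I_1 * ('I_m * 'I_d)) : 'I_(m * d) :=
  rev_ord (bidx p.2.1 p.2.2).

Definition real_cinv (l : 'I_(m * d)) : 'I_1 * ('I_m * 'I_d) :=
  (ord0, unbidx d0 (rev_ord l)).

Lemma real_cidxK : cancel real_cidx real_cinv.
Proof.
by case=> c [i j]; rewrite /real_cinv /real_cidx rev_ordK (bidxK d0 (i, j)) (ord1 c).
Qed.

Lemma real_cinvK : cancel real_cinv real_cidx.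
Proof. by move=> l; rewrite -[RHS]rev_ordK; congr rev_ord; exact: (unbidxK d0). Qed.

Definition realCoords : coords T m d (m * d) :=
  @Coords R T m d (m * d) _ _ real_cidxK real_cinvK.

Lemma gaussR_gE s (f : 'M[R]_(m, d) -> R) :
  gaussR_E m d s f = gE s (fun w => (f (mat realCoords w))%:E).
Proof.
rewrite /gaussR_E gexpE; congr gE; apply/funext => w; congr (f _)%:E.
by apply/matrixP => i j; rewrite !mxE big_ord1 unv_ord mulr1.
Qed.

End RealCase.

Section ComplexCase.
Variable R : realType.
Local Notation T := (complexStar R).

Lemma frob_complex d (A : 'M[R[i]]_d) : frobC A = Num.sqrt (ip (A : 'M[T]_d) A).
Proof.
rewrite /frobC ipE; congr Num.sqrt; apply: eq_bigr => i _; apply: eq_bigr => j _.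
by case: (A i j) => a b /=; ring.
Qed.

Lemma polar_complex d (M : 'M[R[i]]_d) : is_polar (M : 'M[T]_d) (polarC M).
Proof. exact: (@argmin_is_polar R T d M (@frobC R d d) (@frob_complex d)). Qed.

Lemma sv_complex d (G : 'M[R[i]]_d) : 0 <= sv_sumC G <= phi (G : 'M[T]_d).
Proof.
apply: (@svd_trace_le R T) => sv [sv0 [U [V [hU [hV GE]]]]]; split=> //.
by exists U, V.
Qed.

Lemma obj_complex n d k (d0 : (0 < d)%N) (C : 'M[R[i]]_(n * d))
    (V : 'I_n -> 'M[R[i]]_(d, k)) :
  complex.Re (objC C V) =
  ip ((C : 'M[T]_(n * d)) *m stk (T := T) d0 V) (stk (T := T) d0 V).
Proof.
rewrite -(objective_ip (T := T) d0) /objC raddf_sum; apply: eq_bigr => i _.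
by rewrite raddf_sum.
Qed.

Variables (m d : nat) (d0 : (0 < d)%N) (md0 : (0 < m * d)%N).

(** The basis index is outermost, so that all real parts precede all imaginary parts, as in
    [gaussC_E]. *)
Definition complex_cidx (p : 'I_2 * ('I_m * 'I_d)) : 'I_(2 * (m * d)) :=
  rev_ord (bidx p.1 (bidx p.2.1 p.2.2)).

Definition complex_cinv (l : 'I_(2 * (m * d))) : 'I_2 * ('I_m * 'I_d) :=
  let q := unbidx md0 (rev_ord l) in (q.1, unbidx d0 q.2).

Lemma complex_cidxK : cancel complex_cidx complex_cinv.
Proof.
case=> c [i j]; rewrite /complex_cinv /complex_cidx rev_ordK.
by rewrite (bidxK md0 (c, bidx i j)) (bidxK d0 (i, j)).
Qed.

Lemma complex_cinvK : cancel complex_cinv complex_cidx.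
Proof.
move=> l; rewrite -[RHS]rev_ordK; congr rev_ord.
rewrite /complex_cinv; set q := unbidx md0 _.
by rewrite (unbidxK d0) (unbidxK md0).
Qed.

Definition complexCoords : coords T m d (2 * (m * d)) :=
  @Coords R T m d (2 * (m * d)) _ _ complex_cidxK complex_cinvK.

Lemma gaussC_gE t (f : 'M[R[i]]_(m, d) -> R) :
  gaussC_E m d t f =
  gE (Num.sqrt (t / 2)) (fun w => (f (mat complexCoords w))%:E).
Proof.
rewrite /gaussC_E gexpE; congr gE; apply/funext => w; congr (f _)%:E.
apply/matrixP => i j; rewrite !mxE big_ord_recl big_ord1 /= /complex_cidx /=.
rewrite -!unv_ord /= mul0n add0n mul1n /cbasis /=.
by apply/eqP; rewrite eq_complex /=; apply/andP; split; apply/eqP; ring.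
Qed.

End ComplexCase.

Theorem theorem1 (R : realType) (d n : nat) (hd : (0 < d)%N) (hn : (0 < n)%N) :
  (forall (C : 'M[R]_(n * d)), sym_psd C ->
   forall X : 'I_n -> 'M[R]_(d, n * d),
     (forall i, X i *m (X i)^T = 1%:M) ->
     (forall X' : 'I_n -> 'M[R]_(d, n * d),
        (forall i, X' i *m (X' i)^T = 1%:M) -> objR C X' <= objR C X) ->
     forall O : 'I_n -> 'M[R]_d, (forall i, orthogonalR (O i)) ->
       (alphaR R d * alphaR R d * (objR C O)%:E <=
        gaussR_E (n * d) d (Num.sqrt (d%:R^-1))
          (fun G => objR C (fun i => polarR (X i *m G))))%E)
  /\
  (forall (C : 'M[R[i]]_(n * d)), herm_psd C ->
   forall Y : 'I_n -> 'M[R[i]]_(d, n * d),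
     (forall i, Y i *m ctr (Y i) = 1%:M) ->
     (forall Y' : 'I_n -> 'M[R[i]]_(d, n * d),
        (forall i, Y' i *m ctr (Y' i) = 1%:M) ->
        complex.Re (objC C Y') <= complex.Re (objC C Y)) ->
     forall U : 'I_n -> 'M[R[i]]_d, (forall i, unitaryC (U i)) ->
       (alphaC R d * alphaC R d * (complex.Re (objC C U))%:E <=
        gaussC_E (n * d) d (d%:R^-1)
          (fun G => complex.Re (objC C (fun i => polarC (Y i *m G)))))%E).
Proof.
case: d hd => [//|D] _; case: n hn => [//|n'] _.
have dn0 : D.+1%:R != 0 :> R by rewrite pnatr_eq0.
have di0 : 0 < D.+1%:R^-1 :> R by rewrite invr_gt0 ltr0n.
pose d0 := ltn0Sn D; split=> [C [Ct Cpsd] X XX Xmax O hO|C [Ch Cpsd] Y YY Ymax U hU].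
  pose s : R := Num.sqrt D.+1%:R^-1.
  have s0 : s != 0 by rewrite gt_eqF// sqrtr_gt0.
  have sN : (n'.+1 * D.+1 * D.+1)%:R * s ^+ 2 = (n'.+1 * D.+1)%:R :> R.
    by rewrite sqr_sqrtr ?ltW// natrM mulfK.
  have alE : alphaR R D.+1 = gE s (fun u =>
      (D.+1%:R^-1 * sv_sumR (mat (realCoords R D.+1 d0) u))%:E).
    exact: (gaussR_gE d0 s (fun G : 'M[R]_D.+1 => D.+1%:R^-1 * sv_sumR G)).
  rewrite alE (obj_real d0) (gaussR_gE d0).
  under [X in (_ <= gE _ X)%E]eq_fun do rewrite (obj_real d0).
  apply: (@rounding_ratio R (realStar R) s s0 D n' _ _ _ _ sN C X O
    (fun G i => polarR (X i *m G))).
  - by rewrite adj_real.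
  - move=> v; have := Cpsd v; congr (0 <= _).
    rewrite -mulmxA -(adj_real v) /ip mxtrace_mulC.
    by rewrite /mxtrace big_ord1.
  - by move=> i; rewrite adj_real.
  - move=> X' XX'; rewrite -!(obj_real d0); apply: Xmax => i.
    by have := XX' i; rewrite adj_real.
  - by move=> i; rewrite unitary_real.
  - by move=> G i; exact: polar_real.
  - exact: sv_real.
pose s : R := Num.sqrt (D.+1%:R^-1 / 2).
have s0 : s != 0 by rewrite gt_eqF// sqrtr_gt0 divr_gt0.
(* There are twice as many real coordinates as entries, each of half the variance: the mean squared
   norm is the same as in the real case. *)
have sN : (2 * (n'.+1 * D.+1 * D.+1))%:R * s ^+ 2 = (n'.+1 * D.+1)%:R :> R.
  rewrite sqr_sqrtr; last by rewrite ltW// divr_gt0.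
  rewrite natrM (natrM _ (n'.+1 * D.+1)%N D.+1).
  by move: (n'.+1 * D.+1)%:R D.+1%:R dn0 => x y y0; field.
have dd0 : (0 < D.+1 * D.+1)%N by [].
have nd0 : (0 < n'.+1 * D.+1 * D.+1)%N by [].
have alE : alphaC R D.+1 = gE s (fun u =>
    (D.+1%:R^-1 * sv_sumC (mat (complexCoords R d0 dd0) u))%:E).
  exact: (gaussC_gE d0 dd0 (D.+1%:R^-1) (fun G : 'M[R[i]]_D.+1 => D.+1%:R^-1 * sv_sumC G)).
rewrite alE (obj_complex d0) (gaussC_gE d0 nd0).
under [X in (_ <= gE _ X)%E]eq_fun do rewrite (obj_complex d0).
apply: (@rounding_ratio R (complexStar R) s s0 D n' _ _ _ _ sN C Y U
  (fun G i => polarC (Y i *m G))).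
- exact: Ch.
(* The order on [R[i]] also asserts that the value is real; only its real part is kept. *)
- move=> v; have /= := Cpsd v; rewrite lecE => /andP[_].
  congr (0 <= _).
  rewrite -mulmxA /ip mxtrace_mulC.
  by rewrite /mxtrace big_ord1.
- exact: YY.
- by move=> Y' YY'; rewrite -!(obj_complex d0); apply: Ymax.
- exact: hU.
- by move=> G i; exact: polar_complex.
- exact: sv_complex.
Qed.
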